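(* Let $p>2$, $k$ a finite field with $q=p^n$ elements, $K$ a finite totally ramified extension of $W(k)[1/p]$ of degree $e$, and let $V_{\mathbb{F}}$, $M_{\mathbb{F}}$ and the projective $\mathbb{F}$-scheme $\mathscr{GR}^{\mathbf{v}}_{V_{\mathbb{F}},0}$ be as in the context. Let $\mathbb{F}'$ be a finite extension of $\mathbb{F}$, and suppose $x_1,x_2\in\mathscr{GR}^{\mathbf{v}}_{V_{\mathbb{F}},0}(\mathbb{F}')$ correspond to objects $\mathfrak{M}_{1,\mathbb{F}'},\mathfrak{M}_{2,\mathbb{F}'}$ of $(\mathrm{Mod}/\mathfrak{S})_{\mathbb{F}'}$ respectively. If $\mathfrak{M}_{1,\mathbb{F}'}$ and $\mathfrak{M}_{2,\mathbb{F}'}$ are both non-ordinary, then $x_1$ and $x_2$ lie on the same connected component of $\mathscr{GR}^{\mathbf{v}}_{V_{\mathbb{F}},0}$.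
   Context: Setting: $p>2$ prime; $k$ finite of cardinality $q=p^n$; $K_0=W(k)[1/p]$; $K/K_0$ totally ramified of degree $e$, uniformizer $\pi$. $L$ is a finite Galois extension of $\mathbb{Q}_p$ containing $K_0$ with residue field $\mathbb{F}$; fix $k\hookrightarrow\mathbb{F}$. $V_{\mathbb{F}}$ is a continuous two-dimensional $\mathbb{F}$-representation of $G_K$ arising as the generic fiber of a finite flat group scheme over $\mathcal{O}_K$. Following Kisin (''Moduli of finite flat group schemes and modularity''): for $\mathbf{v}=(v_\psi)_\psi$ with $v_\psi=1$ for every $\mathbb{Q}_p$-embedding $\psi:K\to\overline{K_0}$, and a complete local noetherian $\mathcal{O}_L$-algebra $R$ with residue field $\mathbb{F}$ and a formally smooth $\xi\to D^{\mathrm{fl}}_{V_{\mathbb{F}}}$, Kisin constructs a projective morphism $\mathscr{GR}^{\mathbf{v},\mathrm{loc}}_{V_{\mathbb{F}},\xi}\to\mathrm{Spec}\,R^{\mathbf{v}}$ (assumed $R^{\mathbf{v}}\neq0$); $\mathscr{GR}^{\mathbf{v}}_{V_{\mathbb{F}},0}$ is its fiber over the closed point, a projective $\mathbb{F}$-scheme (moduli of finite flat models of $V_{\mathbb{F}}$ with determinant condition). Let $\mathfrak{S}=W(k)[[u]]$, $K_\infty=\bigcup_mK(\pi_m)$ with $\pi_0=\pi$, $\pi_{m+1}^p=\pi_m$, and let $M_{\mathbb{F}}$ be the étale $\phi$-module (free of rank 2 over $k((u))\otimes_{\mathbb{F}_p}\mathbb{F}$) attached by Fontaine's equivalence to $V_{\mathbb{F}}(-1)|_{G_{K_\infty}}$;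 $\phi$ is semilinear for $u\mapsto u^p$, $a\mapsto a^p$ on $k$, identity on $\mathbb{F}$. For $\sigma\in\mathrm{Gal}(k/\mathbb{F}_p)$ let $\epsilon_\sigma$ be the primitive idempotent of $k((u))\otimes_{\mathbb{F}_p}\mathbb{F}\cong\prod_\sigma\mathbb{F}((u))$ (via $(\sum a_iu^i)\otimes b\mapsto(\sum\sigma(a_i)bu^i)_\sigma$). For a finite extension $\mathbb{F}'/\mathbb{F}$, the points of $\mathscr{GR}^{\mathbf{v}}_{V_{\mathbb{F}},0}(\mathbb{F}')$ correspond naturally to the objects of $(\mathrm{Mod}/\mathfrak{S})_{\mathbb{F}'}$ given by free rank-2 $k[[u]]\otimes_{\mathbb{F}_p}\mathbb{F}'$-submodules $\mathfrak{M}_{\mathbb{F}'}\subset M_{\mathbb{F}}\otimes_{\mathbb{F}}\mathbb{F}'$ that are $\phi$-stable and such that for each $\sigma$ the map $\phi:\epsilon_\sigma\mathfrak{M}_{\mathbb{F}'}\to\epsilon_{\sigma\circ\phi^{-1}}\mathfrak{M}_{\mathbb{F}'}$ has determinant $\alpha u^e$ with $\alpha\in\mathbb{F}'[[u]]^\times$. Such an $\mathfrak{M}$ is called ordinary (Kisin) if it is an extension $0\to\mathfrak{M}^{m}\to\mathfrak{M}\to\mathfrak{M}^{\acute et}\to0$ of $\phi$-stable rank-one objects where $\mathfrak{M}^m$ is multiplicative (the linearized Frobenius on each $\epsilon_\sigma$-component is $u^e$ times a unit) and $\mathfrak{M}^{\acute et}$ is étale (the linearized Frobenius is an isomorphism);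 otherwise it is non-ordinary.
   Formalization: ''Ordinary'' here allows either order of the two rank-one pieces (multiplicative sub with étale quotient, or étale sub with multiplicative quotient); with only the order in the context the claim fails, e.g. n=1, e=p+2, φ(e1)=e1, φ(e2)=u^e e2+u^{p+1} e1. *)

(* Defs.v *)
From HB Require Import structures.
From mathcomp Require Import all_boot all_order all_algebra all_field.
From mathcomp Require Import zify.
From mathcomp Require Import boolp classical_sets cardinality fsbigop topology.

Set Implicit Arguments.
Unset Strict Implicit.
Unset Printing Implicit Defensive.

Import Order.TTheory GRing.Theory Num.Theory.
Local Open Scope classical_set_scope.
Local Open Scope ring_scope.

Section LaurentSeries.
Context {A : comNzRingType}.
Implicit Types f g h : int -> A.

Definition bounded_below f := exists N : nat, forall m : int, m < - N%:Z -> f m = 0.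

Record laurent := Laurent {
  lcoef :> int -> A;
  lcoef_bounded : bounded_below lcoef }.

Lemma laurentP (f g : laurent) : (forall m, f m = g m) -> f = g.
Proof.
case: f g => f fb [g gb] /= /funext fg; subst g.
by congr Laurent; exact: Prop_irrelevance.
Qed.

HB.instance Definition _ := gen_eqMixin laurent.
HB.instance Definition _ := gen_choiceMixin laurent.

Lemma bounded_below_mono (m : int) (a : A) :
  bounded_below (fun i => if i == m then a else 0).
Proof.
exists `|m|%N => i im; case: eqP => // im'; move: im; rewrite im'.
by lia.
Qed.
Definition lmono m a : laurent := Laurent (bounded_below_mono m a).

Lemma bounded_below0 : bounded_below (fun=> 0).
Proof. by exists 0. Qed.
Lemma bounded_belowN f : bounded_below f -> bounded_below (fun m => - f m).
Proof. by case=> N fN; exists N => m /fN ->; rewrite oppr0. Qed.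
Lemma bounded_belowD f g :
  bounded_below f -> bounded_below g -> bounded_below (fun m => f m + g m).
Proof.
move=> [N fN] [M gM]; exists (N + M)%N => m mNM.
by rewrite fN ?gM ?addr0 //; lia.
Qed.

Definition ladd (f g : laurent) : laurent :=
  Laurent (bounded_belowD (lcoef_bounded f) (lcoef_bounded g)).
Definition lopp (f : laurent) : laurent := Laurent (bounded_belowN (lcoef_bounded f)).
Definition lzero : laurent := Laurent bounded_below0.

Lemma laddA : associative ladd. Proof. by move=> *; apply: laurentP => m /=; rewrite addrA. Qed.
Lemma laddC : commutative ladd. Proof. by move=> *; apply: laurentP => m /=; rewrite addrC. Qed.
Lemma ladd0 : left_id lzero ladd. Proof. by move=> *; apply: laurentP => m /=; rewrite add0r. Qed.
Lemma laddN : left_inverse lzero lopp ladd.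
Proof. by move=> *; apply: laurentP => m /=; rewrite addNr. Qed.

HB.instance Definition _ := GRing.isZmodule.Build laurent laddA laddC ladd0 laddN.

Definition conv f g (m : int) : A := \sum_(i \in [set: int]) (f i * g (m - i)).

Lemma convE f g (N M t : nat) :
  (forall m : int, m < - N%:Z -> f m = 0) -> (forall m : int, m < - M%:Z -> g m = 0) ->
  conv f g (t%:Z - N%:Z - M%:Z) = \sum_(j < t.+1) f (j%:Z - N%:Z) * g ((t - j)%:Z - M%:Z).
Proof.
move=> fN gM; rewrite /conv.
rewrite -(fsbig_widen [set j%:Z - N%:Z | j in `I_t.+1]); first last.
- move=> i [_ /= iI]; have [iN|Ni] := ltP i (- N%:Z); first by rewrite fN ?mul0r.
  rewrite (gM _) ?mulr0 // ltNge; apply/negP => le; apply: iI.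
  exists (absz (i + N%:Z)).
    by rewrite /= -ltz_nat gez0_abs; lia.
  by rewrite gez0_abs; lia.
- by [].
rewrite fsbig_image; last by move=> x y _ _ /= /addIr [].
rewrite -(fsbig_ord _ _ (fun j => f (j%:Z - N%:Z) * g (t%:Z - N%:Z - M%:Z - (j%:Z - N%:Z)))).
apply: eq_bigr => j _; congr (_ * g _).
by have := ltn_ord j; lia.
Qed.

Lemma conv_lt0 f g (N M : nat) (m : int) :
  (forall m : int, m < - N%:Z -> f m = 0) -> (forall m : int, m < - M%:Z -> g m = 0) ->
  m < - (N + M)%N%:Z -> conv f g m = 0.
Proof.
move=> fN gM mNM; rewrite /conv fsbig1 // => i _.
have [iN|Ni] := ltP i (- N%:Z); first by rewrite fN ?mul0r.
by rewrite gM ?mulr0 //; lia.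
Qed.

Lemma bounded_below_conv f g :
  bounded_below f -> bounded_below g -> bounded_below (conv f g).
Proof. by move=> [N fN] [M gM]; exists (N + M)%N => m; exact: conv_lt0. Qed.

Definition lmul (f g : laurent) : laurent :=
  Laurent (bounded_below_conv (lcoef_bounded f) (lcoef_bounded g)).

Let trunc f (N t : nat) : {poly A} := \poly_(j < t.+1) f (j%:Z - N%:Z).

Let conv_trunc f g (N M s t : nat) :
  (forall m : int, m < - N%:Z -> f m = 0) -> (forall m : int, m < - M%:Z -> g m = 0) ->
  (s <= t)%N -> conv f g (s%:Z - N%:Z - M%:Z) = (trunc f N t * trunc g M t)`_s.
Proof.
move=> fN gM st; rewrite (convE _ fN gM) coefM; apply: eq_bigr => j _.
have js := ltn_ord j.
by rewrite !coef_poly !ifT //; lia.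
Qed.

Let eq_conv f g (N : nat) :
  (forall m : int, m < - N%:Z -> f m = 0) -> (forall m : int, m < - N%:Z -> g m = 0) ->
  (forall t : nat, f (t%:Z - N%:Z) = g (t%:Z - N%:Z)) -> forall m, f m = g m.
Proof.
move=> fN gN fg m; have [mN|Nm] := ltP m (- N%:Z); first by rewrite fN ?gN.
by have := fg (absz (m + N%:Z)); rewrite (_ : (absz (m + N%:Z))%:Z - N%:Z = m) //; lia.
Qed.

Lemma lmulC : commutative lmul.
Proof.
move=> [f [N fN]] [g [M gM]]; apply: laurentP => /=.
apply: (@eq_conv _ _ (N + M)%N) => [m|m|t]; first exact: conv_lt0.
  by rewrite addnC; exact: conv_lt0.
rewrite PoszD opprD addrA (conv_trunc fN gM (leqnn t)).
by rewrite addrAC (conv_trunc gM fN (leqnn t)) mulrC.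
Qed.

Lemma lmulA : associative lmul.
Proof.
move=> [f [N fN]] [g [M gM]] [h [L hL]]; apply: laurentP => /=.
have fgNM m : m < - (N + M)%N%:Z -> conv f g m = 0 by exact: conv_lt0.
have ghML m : m < - (M + L)%N%:Z -> conv g h m = 0 by exact: conv_lt0.
apply: (@eq_conv _ _ (N + M + L)%N) => [m|m|t]; last 1 first.
- rewrite [in LHS](_ : t%:Z - _ = t%:Z - N%:Z - (M + L)%N%:Z); last by lia.
  rewrite [in RHS](_ : t%:Z - _ = t%:Z - (N + M)%N%:Z - L%:Z); last by lia.
  rewrite (convE _ fN ghML) (convE _ fgNM hL).
  transitivity (trunc f N t * (trunc g M t * trunc h L t))`_t.
    rewrite coefM; apply: eq_bigr => j _; rewrite coef_poly ltn_ord; congr (_ * _).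
    by rewrite PoszD opprD addrA (conv_trunc gM hL (leq_subr j t)).
  rewrite mulrA coefM; apply: eq_bigr => j _.
  rewrite [(trunc h _ _)`__]coef_poly ltnS leq_subr; congr (_ * _).
  rewrite PoszD opprD addrA (conv_trunc fN gM (t := t)) //.
  by rewrite -ltnS ltn_ord.
- by rewrite -addnA; exact: conv_lt0.
- exact: conv_lt0.
Qed.

Lemma lmul1 : left_id (lmono 0 1) lmul.
Proof.
move=> f; apply: laurentP => m /=; rewrite /conv.
rewrite -(fsbig_widen [set 0]) //; last first.
  by move=> i [_ /= /eqP/negbTE ->]; rewrite mul0r.
by rewrite fsbig_set1 eqxx mul1r subr0.
Qed.

Lemma lmulDl : left_distributive lmul +%R.
Proof.
move=> [f [N fN]] [g [M gM]] [h [L hL]]; apply: laurentP => /=.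
pose B := (N + M)%N.
have fB (m : int) : m < - B%:Z -> f m = 0 by move=> ?; apply: fN; lia.
have gB (m : int) : m < - B%:Z -> g m = 0 by move=> ?; apply: gM; lia.
have fgB (m : int) : m < - B%:Z -> f m + g m = 0.
  by move=> ?; rewrite fB ?gB ?addr0.
apply: (@eq_conv _ _ (B + L)%N) => [m|m mB|t]; first exact: conv_lt0.
  by rewrite !(@conv_lt0 _ _ B L) ?addr0.
rewrite PoszD opprD addrA !(convE _ _ hL) // -big_split.
by apply: eq_bigr => j _; rewrite mulrDl.
Qed.

Lemma lone_neq0 : lmono 0 1 != 0.
Proof. by apply/eqP => /(congr1 (lcoef ^~ 0)) /= /eqP; rewrite oner_eq0. Qed.

HB.instance Definition _ := GRing.Zmodule_isComNzRing.Build laurent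
  lmulA lmulC lmul1 lmulDl lone_neq0.

End LaurentSeries.
Arguments laurent : clear implicits.

Definition power_series {A : comNzRingType} (f : laurent A) :=
  forall m : int, m < 0 -> f m = 0.
Definition power_series_unit {A : comNzRingType} (f : laurent A) :=
  power_series f /\ exists2 g, power_series g & f * g = 1.
Definition power_series_mx {A : comNzRingType} r s (M : 'M[laurent A]_(r, s)) :=
  forall i j, power_series (M i j).

Section SeriesTheory.
Context {A : comNzRingType}.

Lemma power_seriesP (f : laurent A) :
  power_series f <-> forall m : int, m < - 0%N%:Z -> f m = 0.
Proof. by split=> fP m m0; apply: fP; lia. Qed.

Lemma power_seriesM (f g : laurent A) :
  power_series f -> power_series g -> power_series (f * g).
Proof. by move=> /power_seriesP f0 /power_seriesP g0 m m0; apply: (conv_lt0 f0 g0); lia. Qed.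

Lemma power_series0 : power_series (0 : laurent A). Proof. by []. Qed.

Lemma power_seriesD (f g : laurent A) :
  power_series f -> power_series g -> power_series (f + g).
Proof. by move=> f0 g0 m m0; rewrite [LHS]/= f0 // g0 // addr0. Qed.

Lemma power_series_mono (m : nat) (a : A) : power_series (lmono m%:Z a).
Proof. by move=> i i0 /=; case: eqP => //; lia. Qed.

Lemma power_series_sum (I : finType) (f : I -> laurent A) :
  (forall i, power_series (f i)) -> power_series (\sum_i f i).
Proof.
by move=> fP; apply: big_ind => // f1 f2; exact: power_seriesD.
Qed.

(* f(u) |-> f(u^p): the Frobenius of k((u)) (x) F, read on one factor F((u)). *)
Lemma bounded_below_frob (p : nat) (f : laurent A) :
  bounded_below (fun m => if (p %| m)%Z then f (m %/ p)%Z else 0).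
Proof.
case: (lcoef_bounded f) => N fN; exists (p * N)%N => m mN.
case: ifP => // /dvdzP[q mq]; have [p0|p0] := posnP p; first by lia.
by rewrite mq mulzK ?fN //; nia.
Qed.
Definition lfrob (p : nat) (f : laurent A) : laurent A := Laurent (bounded_below_frob p f).

End SeriesTheory.

Section CoefficientChange.
Context {A B : comNzRingType} (h : {rmorphism A -> B}).

Lemma bounded_below_map (f : laurent A) : bounded_below (fun m => h (f m)).
Proof. by case: (lcoef_bounded f) => N fN; exists N => m /fN ->; rewrite rmorph0. Qed.
Definition lmap (f : laurent A) : laurent B := Laurent (bounded_below_map f).

Lemma lmap_is_zmod_morphism : zmod_morphism lmap.
Proof. by move=> f g; apply: laurentP => m /=; rewrite rmorphB. Qed.

Lemma lmap_mono m a : lmap (lmono m a) = lmono m (h a).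
Proof. by apply: laurentP => i /=; case: eqP; rewrite ?rmorph0. Qed.

Lemma lmap_is_monoid_morphism : monoid_morphism lmap.
Proof.
split=> [|[f [N fN]] [g [M gM]]]; first by rewrite [LHS]lmap_mono rmorph1.
apply: laurentP => m /=.
have hfN (i : int) : i < - N%:Z -> h (f i) = 0 by move/fN->; rewrite rmorph0.
have hgM (i : int) : i < - M%:Z -> h (g i) = 0 by move/gM->; rewrite rmorph0.
have [mN|Nm] := ltP m (- (N + M)%N%:Z).
  by rewrite (conv_lt0 fN gM mN) (conv_lt0 hfN hgM mN) rmorph0.
have -> : m = (absz (m + N%:Z + M%:Z))%:Z - N%:Z - M%:Z by lia.
rewrite (convE _ fN gM) (convE _ hfN hgM) rmorph_sum.
by apply: eq_bigr => j _; rewrite rmorphM.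
Qed.

HB.instance Definition _ := GRing.isZmodMorphism.Build _ _ lmap lmap_is_zmod_morphism.
HB.instance Definition _ := GRing.isMonoidMorphism.Build _ _ lmap lmap_is_monoid_morphism.

Lemma lmap_frob p f : lmap (lfrob p f) = lfrob p (lmap f).
Proof. by apply: laurentP => m /=; case: ifP; rewrite ?rmorph0. Qed.

Lemma power_series_map f : power_series f -> power_series (lmap f).
Proof. by move=> fP m /fP /= ->; rewrite rmorph0. Qed.

Lemma power_series_unit_map f : power_series_unit f -> power_series_unit (lmap f).
Proof.
move=> [fP [g gP fg]]; split; first exact: power_series_map.
by exists (lmap g); [exact: power_series_map|rewrite -rmorphM fg rmorph1].
Qed.

End CoefficientChange.

(* Via k((u)) (x) F = prod_i F((u)), the phi-module M_F is prod_i F((u))^2 with phi from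
   the i-th factor eps_(sigma_i) M_F to the (i+1)-st, cyclically, given by
   x(u) |-> Phi i *m x(u^p); see sigma below for the indexing. *)
Section Moduli.
Context (p n e : nat) (F : finFieldType) (Phi : 'I_n -> 'M[laurent F]_2).

Section OverAlgebra.
Context {A : comNzRingType} (jA : {rmorphism F -> A}).

(* B i is the matrix of phi from the i-th to the (i+1)-st component in the bases formed
   by the columns of g. *)
Definition frob_matrix (g B : 'I_n -> 'M[laurent A]_2) := forall i,
  map_mx (lmap jA) (Phi i) *m map_mx (lfrob p) (g i) = g (ordS i) *m B i.

Definition ue_unit (a : laurent A) :=
  exists2 alpha, power_series_unit alpha & a = lmono e%:Z 1 * alpha.

Definition model_basis (g : 'I_n -> 'M[laurent A]_2) :=
  (forall i, exists g', g i *m g' = 1%:M) /\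
  exists B, [/\ frob_matrix g B, forall i, power_series_mx (B i)
              & forall i, ue_unit (\det (B i))].

Definition lattice_of (g : 'I_n -> 'M[laurent A]_2) (i : 'I_n) : set 'cV[laurent A]_2 :=
  [set y | exists2 x, power_series_mx x & y = g i *m x].

(* The moduli functor: free rank 2 sublattices of M_F (x) A that are stable under phi,
   with determinant u^e times a unit. *)
Record GR_points := GRPoint {
  lattice : 'I_n -> set 'cV[laurent A]_2;
  latticeP : exists2 g, model_basis g & lattice = lattice_of g }.

(* The first column of g i spans the submodule, the second one maps to a basis of the
   quotient. *)
Definition extension_of (quo sub : laurent A -> Prop) (x : GR_points) :=
  exists g B, [/\ (forall i, exists g', g i *m g' = 1%:M),
    lattice x = lattice_of g, frob_matrix g B &
    forall i, [/\ power_series_mx (B i), sub (B i 0 0), B i 1 0 = 0 & quo (B i 1 1)]].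

(* The order of the two rank one pieces depends on the variance of the correspondence
   with group schemes. An extension with a multiplicative submodule and an etale quotient
   always splits, phi being topologically nilpotent on the submodule; the non-split
   ordinary objects have the etale object as submodule. Both orders are admitted. *)
Definition ordinary (x : GR_points) :=
  extension_of power_series_unit ue_unit x \/
  extension_of ue_unit power_series_unit x.

End OverAlgebra.

Section BaseChange.
Context {A B : comNzRingType} (jA : {rmorphism F -> A}) (jB : {rmorphism F -> B}).
Context (h : {rmorphism A -> B}) (hj : forall c, h (jA c) = jB c).

Definition span_map (L : set 'cV[laurent A]_2) : set 'cV[laurent B]_2 :=
  [set y | exists r (v : 'I_r -> 'cV[laurent A]_2) (c : 'I_r -> laurent B),
    [/\ forall l, L (v l), forall l, power_series (c l)
      & y = \sum_l c l *: map_mx (lmap h) (v l)]].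

Lemma span_map_lattice g i :
  span_map (lattice_of g i) = lattice_of (fun i => map_mx (lmap h) (g i)) i.
Proof.
apply/seteqP; split=> y /=.
  move=> [r [v [c [vL cP ->]]]].
  have /choice[x xP] : forall l, exists x, power_series_mx x /\ v l = g i *m x.
    by move=> l; have [x] := vL l; exists x.
  exists (\sum_l c l *: map_mx (lmap h) (x l)).
    move=> a b; rewrite summxE; apply: power_series_sum => l; rewrite !mxE.
    by apply: power_seriesM; [exact: cP|apply: power_series_map; exact: (xP l).1].
  rewrite mulmx_sumr; apply: eq_bigr => l _.
  by rewrite (xP l).2 map_mxM scalemxAr.
move=> [x xP ->]; exists 2, (fun l => g i *m delta_mx l 0), (fun l => x l 0).
split=> [l|l|]; [|exact: xP|].
  exists (delta_mx l 0) => // a b; rewrite mxE.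
  by case: (_ && _); [exact: power_series_mono|exact: power_series0].
rewrite [x in LHS]matrix_sum_delta mulmx_sumr; apply: eq_bigr => l _.
by rewrite big_ord1 map_mxM map_delta_mx scalemxAr.
Qed.

Lemma model_basis_map g :
  model_basis jA g -> model_basis jB (fun i => map_mx (lmap h) (g i)).
Proof.
move=> [gV [C [gC CP Ce]]]; split=> [i|].
  have [g' gg'] := gV i; exists (map_mx (lmap h) g').
  by rewrite -map_mxM gg' map_mx1.
exists (fun i => map_mx (lmap h) (C i)); split=> i.
- rewrite -map_mxM -gC map_mxM; congr (_ *m _); apply/matrixP => a b; rewrite !mxE.
    by apply: laurentP => m /=; rewrite hj.
  by apply: esym; exact: lmap_frob.
- by move=> a b; rewrite mxE; apply: power_series_map; exact: CP.
- have [al alP al_e] := Ce i; exists (lmap h al); first exact: power_series_unit_map.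
  by rewrite det_map_mx al_e rmorphM /= lmap_mono rmorph1.
Qed.

Lemma span_mapP (x : GR_points jA) :
  exists2 g, model_basis jB g & (fun i => span_map (lattice x i)) = lattice_of g.
Proof.
case: x => L /= [g gP ->]; exists (fun i => map_mx (lmap h) (g i)).
  exact: model_basis_map.
by apply/funext => i; exact: span_map_lattice.
Qed.

Definition GR_map (x : GR_points jA) : GR_points jB := GRPoint (span_mapP x).

End BaseChange.

Section Topology.
Context (Om : closedFieldType) (jOm : {rmorphism F -> Om}).

(* The points with values in an algebraically closed extension Om of F, with the Zariski
   topology over F. A scheme carries the final topology for all morphisms from affine
   schemes Spec A, and the universal lattice is free on a covering by affine opens; so U
   is open if, for every x in GR(A), the Om-points of Spec A sent to U by x are a union
   of basic opens D(a). Conjugate points over F are not separated. The components are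
   those of the scheme: if Om is algebraic over F the points of GR_space are its closed
   points, and for larger Om more of its points occur. *)
Definition GR_space := GR_points jOm.

Definition GR_open (U : set GR_space) :=
  forall (A : comNzRingType) (jA : {rmorphism F -> A}) (x : GR_points jA)
    (h : {rmorphism A -> Om}) (hj : forall c, h (jA c) = jOm c),
  U (GR_map hj x) ->
  exists2 a, h a != 0 &
    forall (h' : {rmorphism A -> Om}) (hj' : forall c, h' (jA c) = jOm c),
    h' a != 0 -> U (GR_map hj' x).

Lemma GR_openT : GR_open setT.
Proof. by move=> A jA x h hj _; exists 1; rewrite ?rmorph1 ?oner_neq0. Qed.

Lemma GR_openI : setI_closed GR_open.
Proof.
move=> U V oU oV A jA x h hj [Ux Vx].
have [a ha aU] := oU _ _ _ _ _ Ux; have [b hb bV] := oV _ _ _ _ _ Vx.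
exists (a * b); first by rewrite rmorphM mulf_neq0.
by move=> h' hj'; rewrite rmorphM mulf_eq0 => /norP[/(aU _ hj') ? /(bV _ hj') ?].
Qed.

Lemma GR_open_bigcup (I : Type) (f : I -> set GR_space) :
  (forall i, GR_open (f i)) -> GR_open (\bigcup_i f i).
Proof.
move=> of_ A jA x h hj [i _ fx]; have [a ha aU] := of_ i _ _ _ _ _ fx.
by exists a => // h' hj' /(aU _ hj') ?; exists i.
Qed.

HB.instance Definition _ := gen_eqMixin GR_space.
HB.instance Definition _ := gen_choiceMixin GR_space.
HB.instance Definition _ :=
  isOpenTopological.Build GR_space GR_openT GR_openI GR_open_bigcup.

End Topology.
End Moduli.

Arguments GR_points p {n} e {F} Phi {A} jA.
Arguments GR_space p {n} e {F} Phi {Om} jOm.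

Section DiscreteValuation.
Context {K : fieldType} (v : K -> int).

(* Only the values of v on nonzero elements are meaningful. *)
Definition val_ge (m : int) (x : K) := x = 0 \/ m <= v x.

Definition discrete_valuation :=
  [/\ forall x y, x != 0 -> y != 0 -> v (x * y) = v x + v y,
      forall m x y, val_ge m x -> val_ge m y -> val_ge m (x + y)
    & exists2 x, x != 0 & v x = 1].

Definition valuation_complete := forall x : nat -> K,
  (forall m, exists N, forall i j, (N <= i)%N -> (N <= j)%N -> val_ge m (x i - x j)) ->
  exists l, forall m, exists N, forall i, (N <= i)%N -> val_ge m (x i - l).

Definition residue_map (k : fieldType) (red : K -> k) :=
  [/\ red 1 = 1,
      forall x y, val_ge 0 x -> val_ge 0 y ->
        red (x + y) = red x + red y /\ red (x * y) = red x * red y,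
      forall x, val_ge 0 x -> (red x = 0 <-> val_ge 1 x)
    & forall a, exists2 x, val_ge 0 x & red x = a].

End DiscreteValuation.

(* K0 = W(k)[1/p]: W(k) is the complete discrete valuation ring with uniformizer p
   and residue field k. *)
Definition witt_fraction_field (p : nat) (k K0 : fieldType) (v0 : K0 -> int) (red : K0 -> k) :=
  [/\ discrete_valuation v0, valuation_complete v0, residue_map v0 red,
      p%:R != 0 :> K0 & v0 p%:R = 1].

Definition totally_ramified (K0 : fieldType) (v0 : K0 -> int) (K : fieldExtType K0)
    (v : K -> int) (e : nat) (pi : K) :=
  [/\ \dim {:K} = e, discrete_valuation v,
      forall a : K0, a != 0 -> v a%:A = e%:Z * v0 a, pi != 0 & v pi = 1].

Section GaloisRepresentation.
Context (p n e : nat) {k : finFieldType}.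
Context {K0 : fieldType} (v0 : K0 -> int) (red : K0 -> k).
Context {K : fieldExtType K0} (v : K -> int) (pi : K).
Context {Kbar : closedFieldType} (jK : {rmorphism K -> Kbar}).
Context {F : finFieldType} (iota : {rmorphism k -> F}).

Definition algebraic_closure := forall x : Kbar, algebraicOver jK x.

(* As Kbar / K is algebraic, K-endomorphisms of Kbar are automorphisms. *)
Definition in_GK (g : {rmorphism Kbar -> Kbar}) := forall x, g (jK x) = jK x.

Definition galois_rep (rho : {rmorphism Kbar -> Kbar} -> 'M[F]_2) :=
  (forall g g' gg' : {rmorphism Kbar -> Kbar}, in_GK g -> in_GK g' -> in_GK gg' ->
     (forall x, gg' x = g (g' x)) -> rho gg' = rho g *m rho g') /\
  (exists S : seq Kbar, forall g : {rmorphism Kbar -> Kbar}, in_GK g ->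
     (forall x, x \in S -> g x = x) -> rho g = 1%:M).

(* The affine algebra of a finite flat group scheme over O_K with generic fiber V is
   a Hopf order, free over O_K on a basis (H i), in the Hopf algebra of G_K-equivariant
   functions V -> Kbar. *)
Definition finite_flat (rho : {rmorphism Kbar -> Kbar} -> 'M[F]_2) :=
  exists m (H : 'I_m -> 'cV[F]_2 -> Kbar),
  let in_order (f : 'cV[F]_2 -> Kbar) := exists2 a : 'I_m -> K,
    forall i, val_ge v 0 (a i) & forall x, f x = \sum_i jK (a i) * H i x in
  [/\ forall f, exists! a : 'I_m -> Kbar, forall x, f x = \sum_i a i * H i x,
      forall g, in_GK g -> forall i x, H i (rho g *m x) = g (H i x),
      in_order (fun=> 1) /\ forall i j, in_order (fun x => H i x * H j x),
      forall i, exists2 c : 'I_m -> 'I_m -> K, forall j l, val_ge v 0 (c j l) &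
        forall x y, H i (x + y) = \sum_j \sum_l jK (c j l) * H j x * H l y
    & forall i, in_order (fun x => H i (- x)) /\
        exists2 a, val_ge v 0 a & H i 0 = jK a].

Definition integral_elt (x : Kbar) := exists P : {poly K},
  [/\ P \is monic, forall i, val_ge v 0 P`_i & root (map_poly jK P) x].

Definition cong_p (x y : Kbar) := exists2 z, integral_elt z & x - y = p%:R * z.

(* R = lim O_Kbar / p along x |-> x^p; a sequence represents an element of R, and
   eq_R is equality in R. *)
Definition in_R (x : nat -> Kbar) :=
  forall s, integral_elt (x s) /\ cong_p (x s.+1 ^+ p) (x s).
Definition eq_R (x y : nat -> Kbar) := forall s, cong_p (x s) (y s).

Definition uniformizer_roots (pi_ : nat -> Kbar) :=
  pi_ 0%N = jK pi /\ forall s, pi_ s.+1 ^+ p = pi_ s.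

Definition in_GKoo (pi_ : nat -> Kbar) g := in_GK g /\ forall s, g (pi_ s) = pi_ s.

(* sigma_i = (a |-> a^p)^-i, so that sigma_(i+1) = sigma_i \o phi^-1. *)
Definition sigma (i : 'I_n) (a : k) : F := iota (a ^+ (p ^ (n - i))).

(* M = prod_i F((u))^2, with phi : eps_(sigma_i) M -> eps_(sigma_(i+1)) M given in the
   standard bases by Phi i. For u = (pi_ s)_s in R, a k((u))-linear phi-compatible map
   M -> R[1/u] is u^-c w, where w i j : F -> R is its restriction to the multiples by F
   of the j-th basis vector of eps_(sigma_i) M. As phi is etale, all such maps have this
   form when u^((p - 1) c) Phi is integral. The level s of sum_m u^m y_m only depends on
   the terms with m < e * p ^ s, as pi_s ^ (e * p ^ s) = pi ^ e. *)
Definition phi_hom (pi_ : nat -> Kbar) (Phi : 'I_n -> 'M[laurent F]_2) (c : nat)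
    (w : 'I_n -> 'I_2 -> F -> nat -> Kbar) :=
  [/\ forall i j b, in_R (w i j b),
      forall i j b b', eq_R (w i j (b + b')) (fun s => w i j b s + w i j b' s),
      forall i j a b s t, val_ge v0 0 t -> red t ^+ (p ^ s) = a ->
        cong_p (w i j (sigma i a * b) s) (jK t%:A * w i j b s)
    & forall i j b s N, (e * p ^ s <= N)%N ->
        cong_p (w i j b s ^+ p)
          (\sum_(l < 2) \sum_(m < N)
             pi_ s ^+ m *
             w (ordS i) l (Phi i l j (m%:Z - ((p - 1) * c)%N%:Z) * b) s)].

(* The covariant functor V(-1) |-> M amounts to an isomorphism of F[G_Koo]-modules from
   the dual of V(-1), here row vectors, to Hom_phi(M, R[1/u]). As V(-1) is given by
   chi^-1 rho, with chi the cyclotomic character, g acts on its dual by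
   la |-> chi(g) la rho(g)^-1. *)
Definition etale_phi_module_of (pi_ : nat -> Kbar)
    (rho : {rmorphism Kbar -> Kbar} -> 'M[F]_2) (Phi : 'I_n -> 'M[laurent F]_2) :=
  (forall i, exists Phi', Phi i *m Phi' = 1%:M) /\
  exists c (Theta : 'rV[F]_2 -> 'I_n -> 'I_2 -> F -> nat -> Kbar),
  [/\ forall i l j m, m < - ((p - 1) * c)%N%:Z -> Phi i l j m = 0,
      forall la, phi_hom pi_ Phi c (Theta la),
      (forall la mu i j b,
         eq_R (Theta (la + mu) i j b) (fun s => Theta la i j b s + Theta mu i j b s)) /\
      (forall a la i j b, eq_R (Theta (a *: la) i j b) (Theta la i j (a * b))),
      (forall la, (forall i j b, eq_R (Theta la i j b) (fun=> 0)) -> la = 0) /\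
      (forall w, phi_hom pi_ Phi c w ->
         exists la, forall i j b, eq_R (w i j b) (Theta la i j b))
    & forall g (chi : nat), in_GKoo pi_ g ->
        (forall z : Kbar, z ^+ p = 1 -> g z = z ^+ chi) ->
        forall la i j b,
          eq_R (fun s => g (Theta (la *m rho g) i j b s)) (Theta (chi%:R *: la) i j b)].

End GaloisRepresentation.

(* Main.v *)
Require Import Defs.
From HB Require Import structures.
From mathcomp Require Import all_boot all_order all_algebra all_field.
From mathcomp Require Import perm zify ring.
From mathcomp Require Import boolp classical_sets fsbigop topology.

(** Choose bases e_i, f_i adapted to both lattices (elementary divisors): M1 is spanned by
    e_i, f_i and, by the determinant condition, M2 by u^-a_i e_i, u^a_i f_i with a_i >= 0.
    Let (alpha_i, beta_i; gamma_i, delta_i) be the matrix of phi on M1. A lattice with basis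
    u^-b_i e_i, u^b_i f_i is a model as soon as the weights p b_i - b_(i+1) and
    p b_i + b_(i+1) are compatible with the valuations of these entries, and we go from
    b = 0 to b = a by adding indicator functions of subsets of the circle Z/n.
    Adding the indicator of the support of la is a walk along a projective line, namely
    along the lattices spanned by e_i and f_i + t la_i u^-1 e_i, provided that
    c_i la_i = d_i la_(i+1) for all i, where c_i is the coefficient of u^(p-1) in alpha_i
    and d_i that of 1 in delta_i. This cyclic system has a nonzero solution as soon as some
    c_i and some d_j vanish. If all d_i are nonzero then M1 has an etale line, and if all c_i
    are nonzero then a is constant equal to 1 and M2 has one; both cases are ordinary. *)

Set Implicit Arguments.
Unset Strict Implicit.
Unset Printing Implicit Defensive.

Import Order.TTheory GRing.Theory Num.Theory.
Local Open Scope classical_set_scope.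
Local Open Scope ring_scope.

(** * Valuations of Laurent series and fixed points of contractions *)

Section Valuation.
Context {A : comNzRingType}.
Implicit Types (f g : laurent A) (N M m : int).

Definition vge N f := forall m, m < N -> f m = 0.

Lemma lcoefB f g m : (f - g) m = f m - g m.
Proof. by []. Qed.

Lemma vgeN N f : vge N f -> vge N (- f).
Proof. by move=> fN m /fN fm; rewrite [LHS]/= fm oppr0. Qed.

Lemma vgeD N f g : vge N f -> vge N g -> vge N (f + g).
Proof. by move=> fN gN m mN; rewrite [LHS]/= fN // gN // addr0. Qed.

Lemma vgeB N f g : vge N f -> vge N g -> vge N (f - g).
Proof. by move=> fN gN; apply: vgeD => //; apply: vgeN. Qed.

Lemma vge_le N M f : N <= M -> vge M f -> vge N f.
Proof. by move=> NM fM m mN; apply: fM; lia. Qed.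

Lemma vge_succ N f : vge N f -> f N = 0 -> vge (N + 1) f.
Proof.
move=> fN f0 m mN; have [->//|mN'] := eqVneq m N; apply: fN; lia.
Qed.

Lemma vgeM N M f g : vge N f -> vge M g -> vge (N + M) (f * g).
Proof.
move=> fN gM m mNM; rewrite [LHS]/= /conv fsbig1 // => i _.
have [iN|Ni] := ltP i N; first by rewrite fN ?mul0r.
by rewrite gM ?mulr0 //; lia.
Qed.

(** In the convolution one factor vanishes for [i < N] and the other for [i > N], so a single term
    survives. *)
Lemma lcoefM N M f g : vge N f -> vge M g -> (f * g) (N + M) = f N * g M.
Proof.
move=> fN gM; rewrite [LHS]/= /conv -(fsbig_widen [set N]) //; last first.
  move=> i [_ /= /eqP iN]; have [iN'|Ni] := ltP i N; first by rewrite fN ?mul0r.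
  by rewrite gM ?mulr0 //; lia.
by rewrite fsbig_set1; congr (_ * g _); lia.
Qed.

Lemma lcoef_monoM j a f m : (lmono j a * f) m = a * f (m - j).
Proof.
rewrite [LHS]/= /conv -(fsbig_widen [set j]) //; last first.
  by move=> i [_ /= /eqP/negbTE ->]; rewrite mul0r.
by rewrite fsbig_set1 /= eqxx.
Qed.

Lemma lmonoM i j a b : lmono i a * lmono j b = lmono (i + j) (a * b) :> laurent A.
Proof.
apply: laurentP => m; rewrite lcoef_monoM /= subr_eq addrC.
by case: eqP => _; rewrite ?mulr0.
Qed.

Lemma lmono0 : lmono 0 1 = 1 :> laurent A.
Proof. by []. Qed.

Lemma lmono_eq0 i : lmono i 0 = 0 :> laurent A.
Proof. by apply: laurentP => m /=; case: eqP. Qed.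

Lemma vge_mono N a : vge N (lmono N a).
Proof. by move=> m mN /=; case: eqP => // mN'; move: mN; rewrite mN' ltxx. Qed.

Lemma vge_monoM N j a f : vge (N - j) f -> vge N (lmono j a * f).
Proof. by move=> fN m mN; rewrite lcoef_monoM fN ?mulr0 //; lia. Qed.

Lemma monoM_vge N j f : vge N (lmono j 1 * f) -> vge (N - j) f.
Proof.
move=> fN m mN; have := fN (m + j); rewrite lcoef_monoM mul1r addrK; apply; lia.
Qed.

Lemma power_series1 : power_series (1 : laurent A).
Proof. exact: (power_series_mono 0 1). Qed.

Lemma lcoef1 : (1 : laurent A) 0 = 1.
Proof. by []. Qed.

Lemma vge_eq0 f : (forall N : nat, vge N%:Z f) -> f = 0.
Proof. by move=> fN; apply: laurentP => m; apply: (fN `|m|.+1); lia. Qed.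

(* The limit is read off diagonally: its u^m-coefficient is that of the (m+1)-st iterate. *)
Lemma contraction_fixpoint (I : Type) (G : (I -> laurent A) -> I -> laurent A) :
  (forall z, (forall i, power_series (z i)) -> forall i, power_series (G z i)) ->
  (forall (N : nat) z z', (forall i, power_series (z i)) ->
     (forall i, power_series (z' i)) -> (forall i, vge N (z i - z' i)) ->
     forall i, vge N.+1 (G z i - G z' i)) ->
  exists2 z, forall i, power_series (z i) & forall i, G z i = z i.
Proof.
move=> GP Gc; pose y r := iter r G (fun=> 0).
have yP r i : power_series (y r i) by elim: r i => [|r IH] i //=; apply: GP.
have yS (r : nat) i : vge r (y r.+1 i - y r i).
  elim: r i => [|r IH] i; first by apply: vgeB; [exact: (yP 1%N)|exact: (yP 0%N)].
  by apply: (Gc r (y r.+1) (y r)) => // j; exact: yP.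
have yD (r s : nat) i : vge r (y (r + s)%N i - y r i).
  elim: s => [|s IH]; first by rewrite addn0 subrr.
  rewrite addnS -(subrKA (y (r + s)%N i)); apply: vgeD => //.
  by apply: vge_le (yS _ _); lia.
pose zc i (m : int) := if m < 0 then 0 else y `|m|.+1 i m.
have zb i : bounded_below (zc i).
  by exists 0 => m m0; rewrite /zc ifT //; lia.
pose z i := Laurent (zb i).
have zP i : power_series (z i) by move=> m m0; rewrite /= /zc m0.
have zy (r : nat) i : vge r (z i - y r i).
  move=> m mr /=; rewrite /zc; case: ltP => m0; first by rewrite yP // subrr.
  have -> : y r i m = y (`|m|.+1 + (r - `|m|.+1))%N i m by congr (y _ _ _); lia.
  have /eqP := yD `|m|.+1 (r - `|m|.+1)%N i m ltac:(lia).
  by rewrite [X in X == _]/= subr_eq0 => /eqP ->; rewrite subrr.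
exists z => // i; apply/eqP; rewrite -subr_eq0; apply/eqP; apply: vge_eq0 => r.
rewrite -(subrKA (y r.+1 i)); apply: vgeD.
  have := Gc r z (y r) zP (yP r) (zy r) i.
  by apply: vge_le; lia.
by rewrite -opprB; apply: vgeN; apply: vge_le (zy _ _); lia.
Qed.

End Valuation.

(** * Units and valuations over a field *)

Section LaurentField.
Context {E : fieldType}.
Implicit Types f g : laurent E.

(** For the converse, write [f = c + r] with [c] the nonzero constant term and [r] divisible by u.
    The inverse is the fixed point of z -> c^-1 (1 - r z), a contraction because [r] raises
    valuations. A single series is treated as a family indexed by [unit]. *)
Lemma power_series_unitP f : power_series_unit f <-> power_series f /\ f 0 != 0.
Proof.
split=> [[fP [g gP fg]]|[fP f0]].
  split=> //; apply/eqP => f0; have := lcoefM fP gP.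
  by rewrite fg f0 mul0r addr0 lcoef1 => /eqP; rewrite oner_eq0.
split=> //; set c := f 0 in f0.
pose r := f - lmono 0 c.
have rP : vge 1 r.
  apply: (@vge_succ _ 0) => [|/=]; last by rewrite subrr.
  by apply: vgeB fP _; exact: vge_mono.
have [||g gP gE] := @contraction_fixpoint _ unit (fun z _ => lmono 0 c^-1 * (1 - r * z tt)).
- move=> z zP _; apply: vge_monoM; apply: vgeB; first exact: power_series1.
  by apply: vge_le (vgeM rP (zP tt)).
- move=> N z z' zP z'P zz' _; rewrite -mulrBr; apply: vge_monoM; rewrite subr0.
  have -> : 1 - r * z tt - (1 - r * z' tt) = - (r * (z tt - z' tt)) by ring.
  by apply: vgeN; apply: vge_le (vgeM rP (zz' tt)); lia.
exists (g tt) => //; have := congr1 ( *%R (lmono 0 c)) (gE tt).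
rewrite mulrA lmonoM mulfV // lmono0 mul1r /r mulrBl.
move=> eg; have -> : f * g tt = 1 - (1 - (f * g tt - lmono 0 c * g tt)) + lmono 0 c * g tt.
  by ring.
by rewrite eg subrK.
Qed.

Lemma laurent_valuation f : f != 0 -> exists N : int, vge N f /\ f N != 0.
Proof.
move=> f0; have [M fM] := lcoef_bounded f.
have [m fm] : exists m, f m != 0.
  apply: contrapT => fm; case/eqP: f0; apply: laurentP => m.
  by apply/eqP; apply/negPn/negP => fm'; apply: fm; exists m.
have mM : - M%:Z <= m by rewrite leNgt; apply/negP => /fM fm0; rewrite fm0 eqxx in fm.
have ex : exists r : nat, f (r%:Z - M%:Z) != 0.
  by exists (absz (m + M%:Z)); rewrite (_ : _ - _ = m) //; lia.
case: (ex_minnP ex) => r fr rmin; exists (r%:Z - M%:Z); split=> // l lr.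
have [lM|Ml] := ltP l (- M%:Z); first exact: fM.
apply/eqP; apply/negPn/negP => fl.
have := rmin (absz (l + M%:Z)); rewrite (_ : _ - _ = l); last lia.
by move=> /(_ fl); lia.
Qed.

Lemma laurent_unit f : f != 0 -> exists N w w', [/\ power_series w, power_series w',
  w * w' = 1 & f = lmono N 1 * w].
Proof.
move=> /laurent_valuation[N [fN f0]]; pose w := lmono (- N) 1 * f.
have wP : power_series w by apply: vge_monoM; rewrite add0r opprK.
have /power_series_unitP[_ [w' w'P ww']] : power_series w /\ w 0 != 0.
  by split=> //; rewrite lcoef_monoM mul1r add0r opprK.
by exists N, w, w'; split=> //; rewrite mulrA lmonoM subrr mulr1 lmono0 mul1r.
Qed.

End LaurentField.

(** * The substitution u -> u^p as a ring endomorphism *)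

Section Frobenius.
Context {A : comNzRingType} (p : nat) (p_gt0 : (0 < p)%N).
Implicit Types f g : laurent A.

Lemma lcoef_frobM f (m : int) : lfrob p f (p%:Z * m) = f m.
Proof. by rewrite /= dvdz_mulr // mulKz //; lia. Qed.

Lemma lfrob_ndvd f (m : int) : ~~ (p %| m)%Z -> lfrob p f m = 0.
Proof. by rewrite /= => /negbTE ->. Qed.

Lemma lfrob_is_zmod_morphism : zmod_morphism (@lfrob A p).
Proof. by move=> f g; apply: laurentP => m /=; case: ifP; rewrite ?subr0. Qed.

Lemma lfrob_mono i a : lfrob p (lmono i a) = lmono (p%:Z * i) a :> laurent A.
Proof.
apply: laurentP => m.
have [/dvdzP[q ->]|pm] := boolP (p %| m)%Z.
  rewrite mulrC lcoef_frobM /=; congr (if _ then _ else _).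
  by apply/eqP/eqP; nia.
rewrite lfrob_ndvd //=; case: eqP => // mi; case/negP: pm.
by rewrite mi dvdz_mulr.
Qed.

Lemma lfrob_is_monoid_morphism : monoid_morphism (@lfrob A p).
Proof.
split=> [|f g]; first by rewrite -lmono0 lfrob_mono mulr0.
apply: laurentP => m.
have [/dvdzP[q ->]|pm] := boolP (p %| m)%Z; last first.
  rewrite lfrob_ndvd //= /conv fsbig1 // => i _.
  case: ifP => [pi|_]; last by rewrite mul0r.
  by rewrite rpredBr // (negbTE pm) mulr0.
rewrite (mulrC q) lcoef_frobM /= /conv.
rewrite -[RHS](fsbig_widen [set p%:Z * i | i in [set: int]]) //; last first.
  move=> i [_ /= pi]; rewrite ifF ?mul0r //; apply/negP => /dvdzP[s si].
  by apply: pi; exists s => //; rewrite si mulrC.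
rewrite fsbig_image //; last by move=> x y _ _; nia.
apply: eq_fsbigr => i _; rewrite dvdz_mulr // -mulrBr dvdz_mulr // !mulKz //; lia.
Qed.

Lemma vge_frob (N : int) f : vge N f -> vge (p%:Z * N) (lfrob p f).
Proof.
move=> fN m mN; have [/dvdzP[q mq]|pm] := boolP (p %| m)%Z; last exact: lfrob_ndvd.
by rewrite mq mulrC lcoef_frobM fN //; nia.
Qed.

End Frobenius.

(** * Families of models over the affine line *)

Section AffineLine.
Context (p n e : nat) (F : finFieldType) (Phi : 'I_n -> 'M[laurent F]_2).
Context (E : fieldType) (jE : {rmorphism F -> E}).

Definition line_inc : {rmorphism F -> {poly E}} := polyC \o jE.

Section Evaluation.
Context (R : comNzRingType) (jR : {rmorphism F -> R}).
Context (h : {rmorphism E -> R}) (hj : forall c, h (jE c) = jR c).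

Definition line_ev (t : R) : {rmorphism {poly E} -> R} := horner_eval t \o map_poly h.

Lemma line_evE t P : line_ev t P = (map_poly h P).[t].
Proof. by []. Qed.

Lemma line_evC t c : line_ev t c%:P = h c.
Proof. by rewrite line_evE map_polyC hornerC. Qed.

Lemma line_ev_inc t c : line_ev t (line_inc c) = jR c.
Proof. by rewrite -hj -(line_evC t). Qed.

End Evaluation.

Context (Om : closedFieldType) (jOm : {rmorphism F -> Om}).
Context (h : {rmorphism E -> Om}) (hj : forall c, h (jE c) = jOm c).

(** A point over E[X] is a map from the affine line to the moduli space. Its image is connected
    because any two nonempty open subsets of the line over the infinite field [Om] meet. *)
Lemma affine_line_connected (x : GR_points p e Phi line_inc) (t1 t2 : Om) :
  connected_component [set: GR_space p e Phi jOm]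
    (GR_map (line_ev_inc hj t1) x) (GR_map (line_ev_inc hj t2) x).
Proof.
pose f t : GR_space p e Phi jOm := GR_map (line_ev_inc hj t) x.
exists (range f); last by exists t2.
split=> //.
move=> B [y By] [U oU BU] [V cV BV]; apply/seteqP; split=> [z|z [t _ <-]].
  by rewrite BU => -[].
apply: contrapT => Bft.
have [[s _ fs] Uy] : (range f `&` U) y by rewrite -BU.
have {}Uy : U (f s) by rewrite fs.
have Vft : (~` V) (f t) by move=> Vft; apply: Bft; rewrite BV; split=> //; exists t.
have oV : GR_open (~` V) by exact: (closed_openC cV).
have [a sa aU] := (oU : GR_open U) _ _ _ _ _ Uy.
have [b tb bV] := oV _ _ _ _ _ Vft.
have ab0 : map_poly h (a * b) != 0.
  rewrite map_poly_eq0 mulf_neq0 //.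
    by apply: contraNneq sa => ->; rewrite rmorph0.
  by apply: contraNneq tb => ->; rewrite rmorph0.
(* A common point of the two basic opens: its image lies both in [U] and outside [V], although [U]
   and [V] cut out the same subset of the image. *)
have /closed_nonrootP[r] := ab0.
rewrite rootE rmorphM hornerM mulf_eq0 => /norP[ra rb].
have Bfr : B (f r) by rewrite BU; split; [exists r|exact: aU].
by move: Bfr; rewrite BV => -[_]; exact: bV.
Qed.

End AffineLine.

(** * Two by two matrices by entries *)

Section Matrix2.
Context {R : comNzRingType}.
Implicit Types a b c d : R.

Definition mx2 a b c d : 'M[R]_2 :=
  \matrix_(i, j) if i == 0 then (if j == 0 then a else b) else (if j == 0 then c else d).

Lemma mx2_eta (M : 'M[R]_2) : M = mx2 (M 0 0) (M 0 1) (M 1 0) (M 1 1).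
Proof.
by apply/matrixP => -[[|[|//]] i2] [[|[|//]] j2]; rewrite mxE /=;
  congr (M _ _); apply/val_inj.
Qed.

Lemma mx2E a b c d :
  (mx2 a b c d 0 0 = a) * (mx2 a b c d 0 1 = b) * (mx2 a b c d 1 0 = c) * (mx2 a b c d 1 1 = d).
Proof. by rewrite !mxE. Qed.

Lemma mx2M a b c d a' b' c' d' : mx2 a b c d *m mx2 a' b' c' d' =
  mx2 (a * a' + b * c') (a * b' + b * d') (c * a' + d * c') (c * b' + d * d').
Proof.
by rewrite [LHS]mx2_eta !mxE !big_ord_recl !big_ord0 !addr0 !mxE.
Qed.

Lemma mx2_1 : mx2 1 0 0 1 = 1%:M.
Proof. by rewrite [RHS]mx2_eta !mxE. Qed.

Lemma det_mx2 a b c d : \det (mx2 a b c d) = a * d - b * c.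
Proof.
rewrite (expand_det_row _ 0) !big_ord_recl big_ord0 /cofactor !det_mx11 !mxE /=.
by rewrite expr0 expr1 mul1r addr0 mulN1r mulrN.
Qed.

Lemma det_mx2E (M : 'M[R]_2) : \det M = M 0 0 * M 1 1 - M 0 1 * M 1 0.
Proof. by rewrite {1}[M]mx2_eta det_mx2. Qed.

End Matrix2.

Lemma map_mx2 (R S : comNzRingType) (f : R -> S) a b c d :
  map_mx f (mx2 a b c d) = mx2 (f a) (f b) (f c) (f d).
Proof. by rewrite [LHS]mx2_eta !mxE. Qed.

(** * Integral matrices and their Frobenius twists *)

Section IntegralMatrices.
Context {A : comNzRingType}.

Definition ps_unitmx (P : 'M[laurent A]_2) :=
  power_series_mx P /\ exists2 P', power_series_mx P' & P *m P' = 1%:M.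

Lemma power_series_mxM (r s t : nat) (M : 'M[laurent A]_(r, s)) (N : 'M_(s, t)) :
  power_series_mx M -> power_series_mx N -> power_series_mx (M *m N).
Proof.
move=> MP NP i j; rewrite mxE; apply: power_series_sum => l.
by apply: power_seriesM; [exact: MP|exact: NP].
Qed.

Lemma power_series_mx2 (a b c d : laurent A) : power_series a -> power_series b ->
  power_series c -> power_series d -> power_series_mx (mx2 a b c d).
Proof. by move=> aP bP cP dP i j; rewrite mxE; case: eqP; case: eqP. Qed.

Lemma power_series_mx2_inv (a b c d : laurent A) : power_series_mx (mx2 a b c d) ->
  [/\ power_series a, power_series b, power_series c & power_series d].
Proof.
move=> M; have := (M 0 0, M 0 1, M 1 0, M 1 1).
by rewrite !mx2E => -[[[]]].
Qed.

Lemma power_series_det (M : 'M[laurent A]_2) : power_series_mx M -> power_series (\det M).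
Proof.
move=> MP; rewrite det_mx2E; apply: vgeB; apply: power_seriesM; exact: MP.
Qed.

Lemma power_series_unitM (f g : laurent A) :
  power_series_unit f -> power_series_unit g -> power_series_unit (f * g).
Proof.
move=> [fP [f' f'P ff']] [gP [g' g'P gg']]; split; first exact: power_seriesM.
by exists (f' * g'); [exact: power_seriesM|rewrite mulrACA ff' gg' mulr1].
Qed.

Lemma ps_unitmx_det P : ps_unitmx P -> power_series_unit (\det P).
Proof.
move=> [PP [P' P'P PP']]; split; first exact: power_series_det.
by exists (\det P'); [exact: power_series_det|rewrite -det_mulmx PP' det1].
Qed.

Lemma ps_unitmx1 : ps_unitmx 1%:M.
Proof.
have P1 : power_series_mx (1%:M : 'M[laurent A]_2).
  rewrite -mx2_1; apply: power_series_mx2 => //; exact: power_series1.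
by split=> //; exists 1%:M; rewrite ?mulmx1.
Qed.

Lemma ps_unitmxM P Q : ps_unitmx P -> ps_unitmx Q -> ps_unitmx (P *m Q).
Proof.
move=> [PP [P' P'P PP']] [QP [Q' Q'P QQ']]; split; first exact: power_series_mxM.
exists (Q' *m P'); first exact: power_series_mxM.
by rewrite mulmxA -(mulmxA P) QQ' mulmx1 PP'.
Qed.

Lemma ps_unitmx_swap : ps_unitmx (mx2 0 1 1 0).
Proof.
have sP : power_series_mx (mx2 0 1 1 0 : 'M[laurent A]_2).
  by apply: power_series_mx2 => //; exact: power_series1.
by split=> //; exists (mx2 0 1 1 0) => //; rewrite mx2M -mx2_1; congr mx2; ring.
Qed.

Lemma power_series_frob p (f : laurent A) : (0 < p)%N ->
  power_series f -> power_series (lfrob p f).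
Proof. by move=> p_gt0 fP; have := vge_frob p_gt0 fP; rewrite mulr0. Qed.

(** The positivity of [p] is an argument so that the ring morphism structure can depend on it: for
    [p = 0] the substitution keeps only the constant coefficient and is not multiplicative. *)
Definition frobenius p & (0 < p)%N := @lfrob A p.
HB.instance Definition _ p (p_gt0 : (0 < p)%N) :=
  GRing.isZmodMorphism.Build _ _ (frobenius p_gt0) (lfrob_is_zmod_morphism p).
HB.instance Definition _ p (p_gt0 : (0 < p)%N) :=
  GRing.isMonoidMorphism.Build _ _ (frobenius p_gt0) (lfrob_is_monoid_morphism p_gt0).

Lemma map_frobM p (p_gt0 : (0 < p)%N) r s t (M : 'M[laurent A]_(r, s)) (N : 'M_(s, t)) :
  map_mx (lfrob p) (M *m N) = map_mx (lfrob p) M *m map_mx (lfrob p) N.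
Proof. exact: (map_mxM (frobenius p_gt0)). Qed.

Lemma det_map_frob p (p_gt0 : (0 < p)%N) (M : 'M[laurent A]_2) :
  \det (map_mx (lfrob p) M) = lfrob p (\det M).
Proof. exact: (det_map_mx (frobenius p_gt0)). Qed.

Lemma lfrobM p (p_gt0 : (0 < p)%N) (f g : laurent A) :
  lfrob p (f * g) = lfrob p f * lfrob p g.
Proof. exact: (rmorphM (frobenius p_gt0)). Qed.

Lemma lfrob1 p (p_gt0 : (0 < p)%N) : lfrob p 1 = 1 :> laurent A.
Proof. exact: (rmorph1 (frobenius p_gt0)). Qed.

Lemma lfrob0 p : lfrob p 0 = 0 :> laurent A.
Proof. by apply: laurentP => m /=; case: ifP. Qed.

Lemma lfrobB p (f g : laurent A) : lfrob p (f - g) = lfrob p f - lfrob p g.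
Proof. exact: lfrob_is_zmod_morphism. Qed.

Lemma ps_unitmx_frob p P : (0 < p)%N -> ps_unitmx P -> ps_unitmx (map_mx (lfrob p) P).
Proof.
move=> p_gt0 [PP [P' P'P PP']]; split.
  by move=> i j; rewrite mxE; exact: power_series_frob.
exists (map_mx (lfrob p) P').
  by move=> i j; rewrite mxE; exact: power_series_frob.
by rewrite -(map_frobM p_gt0) PP'; exact: (map_mx1 (frobenius p_gt0)).
Qed.

End IntegralMatrices.

(** * Bases of models and changes of basis *)

Section Bases.
Context (p n e : nat) (p_gt0 : (0 < p)%N) (F : finFieldType) (Phi : 'I_n -> 'M[laurent F]_2).
Context {A : comNzRingType} (jA : {rmorphism F -> A}).
Implicit Types g B : 'I_n -> 'M[laurent A]_2.

Lemma GR_points_eq (x y : GR_points p e Phi jA) : lattice x = lattice y -> x = y.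
Proof.
case: x y => L Lx [L' Ly] /= LL'; subst L'.
by congr GRPoint; exact: Prop_irrelevance.
Qed.

Lemma lattice_of_mulr g P : (forall i, ps_unitmx (P i)) ->
  lattice_of (fun i => g i *m P i) = lattice_of g.
Proof.
move=> PU; apply/funext => i; have [PP [P' P'P PP']] := PU i.
apply/seteqP; split=> y /= [x xP ->].
  by exists (P i *m x); [exact: power_series_mxM|rewrite mulmxA].
exists (P' *m x); first exact: power_series_mxM.
by rewrite mulmxA -(mulmxA (g i)) PP' mulmx1.
Qed.

(** Exposes the Frobenius matrix that [model_basis] hides behind an existential; every later
    argument reads off its entries. *)
Definition model_data g B := [/\ forall i, exists V, g i *m V = 1%:M,
  frob_matrix p Phi jA g B, forall i, power_series_mx (B i)
  & forall i, ue_unit e (\det (B i))].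

Lemma model_dataP g : model_basis p e Phi jA g <-> exists B, model_data g B.
Proof.
split=> [[gV [B [gB BP Be]]]|[B [gV gB BP Be]]]; first by exists B; split.
by split=> //; exists B; split.
Qed.

Lemma frob_matrix_mulr g B P P' : frob_matrix p Phi jA g B ->
  (forall i, P i *m P' i = 1%:M) ->
  frob_matrix p Phi jA (fun i => g i *m P i)
    (fun i => P' (ordS i) *m B i *m map_mx (lfrob p) (P i)).
Proof.
move=> gB PP' i; rewrite (map_frobM p_gt0) mulmxA gB !mulmxA.
by rewrite -[g _ *m P _ *m P' _]mulmxA PP' mulmx1.
Qed.

Lemma model_data_mulr g B P P' : model_data g B ->
  (forall i, power_series_mx (P i)) -> (forall i, power_series_mx (P' i)) ->
  (forall i, P i *m P' i = 1%:M) ->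
  model_data (fun i => g i *m P i) (fun i => P' (ordS i) *m B i *m map_mx (lfrob p) (P i)).
Proof.
move=> [gV gB BP Be] PP P'P PP'.
have PU i : ps_unitmx (P i) by split=> //; exists (P' i).
have P'U i : ps_unitmx (P' i) by split=> //; exists (P i) => //; apply: mulmx1C.
split=> [i||i|i].
- have [g' gg'] := gV i; exists (P' i *m g').
  by rewrite mulmxA -(mulmxA (g i)) PP' mulmx1.
- exact: frob_matrix_mulr.
- do 2?apply: power_series_mxM => //.
  by case: (ps_unitmx_frob p_gt0 (PU i)).
- have [al alU alE] := Be i.
  exists (\det (P' (ordS i)) * al * \det (map_mx (lfrob p) (P i))).
    do 2?apply: power_series_unitM => //; apply: ps_unitmx_det => //.
    exact: ps_unitmx_frob.
  rewrite !det_mulmx alE; ring.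
Qed.

Lemma frob_matrix_inj g B B' : (forall i, exists V, g i *m V = 1%:M) ->
  frob_matrix p Phi jA g B -> frob_matrix p Phi jA g B' -> forall i, B i = B' i.
Proof.
move=> gV gB gB' i; have [g' gg'] := gV (ordS i).
have g'g := mulmx1C gg'.
by rewrite -[B i]mul1mx -[B' i]mul1mx -g'g -!mulmxA -gB -gB'.
Qed.

Lemma exists_point g B : model_data g B ->
  exists x : GR_points p e Phi jA, lattice x = lattice_of g.
Proof.
move=> gB; have gP : model_basis p e Phi jA g by apply/model_dataP; exists B.
have xP : exists2 g1, model_basis p e Phi jA g1 & lattice_of g = lattice_of g1 by exists g.
by exists (GRPoint xP).
Qed.

End Bases.

Lemma lattice_GR_map (p n e : nat) (F : finFieldType) (Phi : 'I_n -> 'M[laurent F]_2)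
    (A B : comNzRingType) (jA : {rmorphism F -> A}) (jB : {rmorphism F -> B})
    (h : {rmorphism A -> B}) (hj : forall c, h (jA c) = jB c)
    (x : GR_points p e Phi jA) g : lattice x = lattice_of g ->
  lattice (GR_map hj x) = lattice_of (fun i => map_mx (lmap h) (g i)).
Proof. by move=> /= ->; apply/funext => i; exact: span_map_lattice. Qed.

(** * Unipotent deformations over the line *)

Section Unipotent.
Context (p n e : nat) (p_gt0 : (0 < p)%N) (F : finFieldType) (Phi : 'I_n -> 'M[laurent F]_2).
Context (E : fieldType) (jE : {rmorphism F -> E}).
Implicit Types (g B : 'I_n -> 'M[laurent E]_2) (nu : 'I_n -> laurent E).

Let c : {rmorphism E -> {poly E}} := polyC.
Let T : laurent {poly E} := lmono 0 'X.

(** The variable 'X is the parameter of the line: the value 0 gives back [g], the value 1 its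
    translate by the unipotent matrix of [nu]. *)
Definition line_basis g nu i : 'M[laurent {poly E}]_2 :=
  map_mx (lmap c) (g i) *m mx2 1 (T * lmap c (nu i)) 0 1.

Lemma line_basis_ev (R : comNzRingType) (k : {rmorphism E -> R}) t g nu i :
  map_mx (lmap (line_ev k t)) (line_basis g nu i) =
  map_mx (lmap k) (g i) *m mx2 1 (lmono 0 t * lmap k (nu i)) 0 1.
Proof.
have lck f : lmap (line_ev k t) (lmap c f) = lmap k f.
  by apply: laurentP => m; exact: line_evC.
have lckM : map_mx (lmap (line_ev k t)) (map_mx (lmap c) (g i)) = map_mx (lmap k) (g i).
  by apply/matrixP => a b; rewrite !mxE; exact: lck.
have lT : lmap (line_ev k t) T = lmono 0 t.
  by rewrite lmap_mono line_evE map_polyX hornerX.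
by rewrite map_mxM map_mx2 rmorphM rmorph1 rmorph0 lckM /= lck lT.
Qed.

Lemma frob_matrix_lift g B : frob_matrix p Phi jE g B ->
  frob_matrix p Phi (line_inc jE) (fun i => map_mx (lmap c) (g i))
    (fun i => map_mx (lmap c) (B i)).
Proof.
move=> gB i; rewrite -map_mxM -gB map_mxM; congr mulmx; apply/matrixP => a b.
  by rewrite !mxE; apply: laurentP.
by rewrite !mxE; apply: esym; exact: lmap_frob.
Qed.

Let power_series_T f : power_series f -> power_series (T * lmap c f).
Proof.
move=> fP; apply: power_seriesM; first exact: (power_series_mono 0).
exact: power_series_map.
Qed.

(** The twisted conjugate of [B] has entries of degree at most 2 in T. The first two hypotheses make
    the linear terms on the diagonal integral; the third and fourth do so for the terms in T and T^2
    of the upper right entry. The lower left entry is unchanged. *)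
Lemma line_data g B nu : model_data p e Phi jE g B ->
  (forall i, power_series (nu (ordS i) * B i 1 0)) ->
  (forall i, power_series (B i 1 0 * lfrob p (nu i))) ->
  (forall i, power_series (B i 0 0 * lfrob p (nu i) - nu (ordS i) * B i 1 1)) ->
  (forall i, power_series (nu (ordS i) * B i 1 0 * lfrob p (nu i))) ->
  exists C, model_data p e Phi (line_inc jE) (line_basis g nu) C.
Proof.
move=> [gV gB BP Be] nu1 nu2 nu3 nu4.
(* The parameter is constant in u, and the Frobenius acts trivially on coefficients. *)
have frobT : lfrob p T = T by rewrite lfrob_mono // mulr0.
pose U i := mx2 1 (T * lmap c (nu i)) 0 1.
pose U' i := mx2 1 (- (T * lmap c (nu i))) 0 1.
have UU' i : U i *m U' i = 1%:M by rewrite mx2M -mx2_1; congr mx2; ring.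
exists (fun i => U' (ordS i) *m map_mx (lmap c) (B i) *m map_mx (lfrob p) (U i)).
split=> [i||i|i].
- have [V gVi] := gV i; exists (U' i *m map_mx (lmap c) V).
  rewrite mulmxA /line_basis -/(U i) -(mulmxA (map_mx (lmap c) (g i))) UU' mulmx1.
  by rewrite -map_mxM gVi map_mx1.
- exact: (frob_matrix_mulr p_gt0 (frob_matrix_lift gB) UU').
- rewrite [B i]mx2_eta !map_mx2 lfrob1 // lfrob0 lfrobM // frobT -lmap_frob !mx2M.
  have bP r s : power_series (lmap c (B i r s)) by apply: power_series_map; exact: BP.
  have := (power_series_T (nu1 i), power_series_T (nu2 i),
           power_series_T (nu3 i), power_series_T (nu4 i)).
  move: (bP 0 0) (bP 0 1) (bP 1 0) (bP 1 1).
  rewrite rmorphB !rmorphM /=.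
  move: (lmap c (B i 0 0)) (lmap c (B i 0 1)) (lmap c (B i 1 0)) (lmap c (B i 1 1)).
  move: (lmap c (nu (ordS i))) (lmap c (lfrob p (nu i))).
  move=> v w b00 b01 b10 b11 P00 P01 P10 P11 [[[P1 P2] P3] P4].
  apply: power_series_mx2.
  + have -> : (1 * b00 + - (T * v) * b10) * 1 + (1 * b01 + - (T * v) * b11) * 0 =
      b00 - T * (v * b10) by ring.
    exact: vgeB.
  + have -> : (1 * b00 + - (T * v) * b10) * (T * w) + (1 * b01 + - (T * v) * b11) * 1 =
      b01 + T * (b00 * w - v * b11) - T * (T * (v * b10 * w)) by ring.
    apply: vgeB; first exact: vgeD.
    apply: power_seriesM => //; exact: (power_series_mono 0).
  + by have -> : (0 * b00 + 1 * b10) * 1 + (0 * b01 + 1 * b11) * 0 = b10 by ring.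
  + have -> : (0 * b00 + 1 * b10) * (T * w) + (0 * b01 + 1 * b11) * 1 =
      b11 + T * (b10 * w) by ring.
    exact: vgeD.
- have [al alU alE] := Be i; exists (lmap c al); first exact: power_series_unit_map.
  rewrite !det_mulmx det_map_mx det_map_frob // alE !det_mx2 rmorphM /= lmap_mono rmorph1.
  by rewrite !mulr0 !subr0 !mulr1 lfrob1 // mul1r mulr1.
Qed.

Context (Om : closedFieldType) (jOm : {rmorphism F -> Om}).
Context (h : {rmorphism E -> Om}) (hj : forall c, h (jE c) = jOm c).

Definition same_component (x y : GR_points p e Phi jE) :=
  connected_component [set: GR_space p e Phi jOm] (GR_map hj x) (GR_map hj y).

Lemma unipotent_same_component g B nu (x : GR_points p e Phi jE) :
  model_data p e Phi jE g B ->
  (forall i, power_series (nu (ordS i) * B i 1 0)) ->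
  (forall i, power_series (B i 1 0 * lfrob p (nu i))) ->
  (forall i, power_series (B i 0 0 * lfrob p (nu i) - nu (ordS i) * B i 1 1)) ->
  (forall i, power_series (nu (ordS i) * B i 1 0 * lfrob p (nu i))) ->
  lattice x = lattice_of g ->
  exists2 y, lattice y = lattice_of (fun i => g i *m mx2 1 (nu i) 0 1) & same_component x y.
Proof.
move=> gB nu1 nu2 nu3 nu4 xE.
have [C data] := line_data gB nu1 nu2 nu3 nu4.
have [X XE] := exists_point data.
have evX (R : comNzRingType) (jR : {rmorphism F -> R}) (k : {rmorphism E -> R})
    (kj : forall c, k (jE c) = jR c) t : lattice (GR_map (line_ev_inc kj t) X) =
    lattice_of (fun i => map_mx (lmap k) (g i) *m mx2 1 (lmono 0 t * lmap k (nu i)) 0 1).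
  rewrite (lattice_GR_map _ XE); congr lattice_of; apply/funext => i.
  exact: line_basis_ev.
(* Evaluating at 1 with values in [E] itself makes the far end of the line a point over [E]; its
   base change to [Om] is then the value at 1 of the family over [Om]. *)
have idj a : (idfun : {rmorphism E -> E}) (jE a) = jE a by [].
have yE : lattice (GR_map (line_ev_inc idj 1) X) =
    lattice_of (fun i => g i *m mx2 1 (nu i) 0 1).
  have lid f : lmap (idfun : {rmorphism E -> E}) f = f by apply: laurentP.
  rewrite evX; congr lattice_of; apply/funext => i; rewrite lid lmono0 mul1r.
  by congr (_ *m _); apply/matrixP => a b; rewrite mxE lid.
exists (GR_map (line_ev_inc idj 1) X); first exact: yE.
have E0 : GR_map (line_ev_inc hj 0) X = GR_map hj x.
  apply/GR_points_eq/(etrans (evX _ _ _ hj 0))/(etrans _ (esym (lattice_GR_map hj xE))).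
  congr lattice_of; apply/funext => i.
  by rewrite lmono_eq0 mul0r mx2_1 mulmx1.
have E1 : GR_map (line_ev_inc hj 1) X = GR_map hj (GR_map (line_ev_inc idj 1) X).
  apply/GR_points_eq/(etrans (evX _ _ _ hj 1))/(etrans _ (esym (lattice_GR_map hj yE))).
  congr lattice_of; apply/funext => i.
  by rewrite map_mxM map_mx2 rmorph1 rmorph0 lmono0 mul1r.
have := affine_line_connected hj X 0 1; rewrite /same_component E0 E1; exact.
Qed.

End Unipotent.

(** * Etale lines and ordinary models *)

Section EtaleSubmodule.
Context (p n e : nat) (p_gt0 : (0 < p)%N) (e_gt0 : (0 < e)%N).
Context (F : finFieldType) (Phi : 'I_n -> 'M[laurent F]_2).
Context (E : fieldType) (jE : {rmorphism F -> E}).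

(* The etale line is spanned by (z_i, 1), where z is the fixed point of the contraction
   z_(i+1) = (beta_i + alpha_i phi(z_i)) / (delta_i + gamma_i phi(z_i)). *)
Lemma etale_ordinary g B (x : GR_points p e Phi jE) :
  model_data p e Phi jE g B -> lattice x = lattice_of g ->
  (forall i, vge 1 (B i 1 0)) -> (forall i, B i 1 1 0 != 0) -> ordinary x.
Proof.
move=> gB xE ga de; have [gV gBf BP Be] := gB.
(* A total choice of inverses, with value 0 off the units; the denominators [den z i] are units as
   soon as [z i] is integral. *)
have /choice[inv invP] : forall f : laurent E, exists f', power_series_unit f ->
    power_series f' /\ f * f' = 1.
  move=> f; have [[fP [f' f'P ff']]|Nf] := pselect (power_series_unit f).
    by exists f'.
  by exists 0.
pose den z i := B i 1 1 + B i 1 0 * lfrob p (z i).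
pose num z i := B i 0 1 + B i 0 0 * lfrob p (z i).
have denU z i : power_series (z i) -> power_series_unit (den z i).
  move=> zP; have wP : vge 0 (lfrob p (z i)) by exact: power_series_frob.
  have gP := vgeM (ga i) wP; apply/power_series_unitP; split.
    by apply: vgeD; [exact: BP|exact: vge_le gP].
  by rewrite /den [X in X != 0]/= [X in _ + X]gP ?addr0 ?de.
have numP z i : power_series (z i) -> power_series (num z i).
  move=> zP; apply: vgeD; first exact: BP.
  by apply: power_seriesM; [exact: BP|exact: power_series_frob].
have [||z zP zE] := @contraction_fixpoint _ _
    (fun z i => num z (ord_pred i) * inv (den z (ord_pred i))).
- move=> z zP i; apply: power_seriesM; first exact: numP.
  by case: (invP _ (denU _ _ (zP (ord_pred i)))).
- move=> N z z' zP z'P zz' i; set j := ord_pred i.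
  have [IP dI] := invP _ (denU _ _ (zP j)); have [IP' dI'] := invP _ (denU _ _ (z'P j)).
  (* Two values of a homography differ by its determinant times the difference of the arguments,
     over the product of the denominators. The determinant contributes [e > 0] and the Frobenius
     turns [N] into [p * N], so the valuation rises by at least one. *)
  have -> : num z j * inv (den z j) - num z' j * inv (den z' j) =
      \det (B j) * lfrob p (z j - z' j) * (inv (den z j) * inv (den z' j)).
    rewrite -[num z j * _]mulr1 -[X in _ * X - _]dI' -[num z' j * _]mulr1.
    rewrite -[X in _ - _ * X]dI lfrobB det_mx2E.
    move: (inv _) (inv _) => I I'; rewrite /num /den; ring.
  have [al [alP _] ->] := Be j.
  have eP : vge e%:Z (lmono e%:Z 1 * al) by apply: vge_monoM; rewrite subrr.
  have := vgeM (vgeM eP (vge_frob p_gt0 (zz' j))) (power_seriesM IP IP' : vge 0 _).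
  by apply: vge_le; nia.
(* The first column is the generator of the line, the second completes it to a basis. *)
pose P i := mx2 (z i) 1 1 0; pose P' i := mx2 0 1 1 (- z i).
have PP i : power_series_mx (P i).
  by apply: power_series_mx2 => //; exact: power_series1.
have P'P i : power_series_mx (P' i).
  apply: power_series_mx2 => //; [exact: power_series1..|].
  by apply: vgeN; exact: zP.
have PP' i : P i *m P' i = 1%:M by rewrite mx2M -mx2_1; congr mx2; ring.
pose g1 i := g i *m P i.
pose B1 i := P' (ordS i) *m B i *m map_mx (lfrob p) (P i).
have [gV' gB' BP' Be'] : model_data p e Phi jE g1 B1 by exact: model_data_mulr.
(* The etale line is the submodule, which is the second alternative of [ordinary]. *)
right; exists g1, B1; split=> // [|i].
  by rewrite xE lattice_of_mulr // => i; split=> //; exists (P' i).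
have [IP dI] := invP _ (denU _ _ (zP i)).
have zi : num z i = z (ordS i) * den z i.
  by rewrite -zE ordSK -mulrA [inv _ * _]mulrC dI mulr1.
(* The lower left entry is the numerator minus [z (ordS i)] times the denominator, which vanishes by
   the fixed point equation. *)
have B1E : B1 i = mx2 (den z i) (B i 1 0) 0 (B i 0 0 - z (ordS i) * B i 1 0).
  rewrite /B1 [B i]mx2_eta map_mx2 lfrob1 // lfrob0 !mx2M !mx2E.
  rewrite -[in RHS](subrr (z (ordS i) * den z i)) -[X in X - _]zi /num /den.
  by congr mx2; ring.
have [al alU alE] := Be' i.
split; [exact: BP'|..]; rewrite B1E ?mx2E //; first exact: (denU _ _ (zP i)).
exists (al * inv (den z i)).
  apply: power_series_unitM => //; split=> //; exists (den z i); last by rewrite mulrC.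
  by case: (denU _ _ (zP i)).
rewrite mulrA -alE B1E det_mx2 mulr0 subr0.
by rewrite [den z i * _]mulrC -mulrA dI mulr1.
Qed.

End EtaleSubmodule.

(** * Elementary divisors over Laurent series *)

Section Cartan.
Context {E : fieldType}.

Let swap (i : 'I_2) : 'M[laurent E]_2 := if i == 0 then 1%:M else mx2 0 1 1 0.

Let swap_unit i : ps_unitmx (swap i).
Proof. by rewrite /swap; case: ifP => _; [exact: ps_unitmx1|exact: ps_unitmx_swap]. Qed.

Let swapK i : swap i *m swap i = 1%:M.
Proof.
rewrite /swap; case: ifP => _; first by rewrite mulmx1.
by rewrite mx2M -mx2_1; congr mx2; ring.
Qed.

(** Supplies the pivot of the elimination: an entry of minimal valuation divides all the others. The
    common bound [K] moves the valuations into the naturals, where a minimum exists. *)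
Lemma min_valuation_entry (M : 'M[laurent E]_2) : M != 0 ->
  exists s i0 j0, (forall i j, vge s (M i j)) /\ M i0 j0 s != 0.
Proof.
move=> M0.
have /choice[N NP] : forall ij : 'I_2 * 'I_2, exists N : nat, forall m : int,
    m < - N%:Z -> M ij.1 ij.2 m = 0 by move=> ij; exact: lcoef_bounded.
pose K := (\sum_ij N ij)%N.
have KP i j (m : int) : m < - K%:Z -> M i j m = 0.
  move=> mK; apply: (NP (i, j)); have : (N (i, j) <= K)%N by rewrite /K (bigD1 (i, j)) ?leq_addr.
  lia.
have [i [j Mij]] : exists i j, M i j != 0.
  apply: contrapT => Mij; case/eqP: M0; apply/matrixP => i j; rewrite mxE.
  by apply/eqP; apply/negPn/negP => ?; apply: Mij; exists i, j.
have [m [mP Mm]] := laurent_valuation Mij.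
have ex : exists r : nat, [exists i, exists j, M i j (r%:Z - K%:Z) != 0].
  exists (absz (m + K%:Z)); apply/existsP; exists i; apply/existsP; exists j.
  have mK : - K%:Z <= m by rewrite leNgt; apply/negP => /KP fm0; rewrite fm0 eqxx in Mm.
  by rewrite (_ : _ - _ = m) //; lia.
case: (ex_minnP ex) => r /existsP[i0 /existsP[j0 M0']] rmin.
exists (r%:Z - K%:Z), i0, j0; split=> // a b l lr.
have [lM|Ml] := ltP l (- K%:Z); first exact: KP.
apply/eqP; apply/negPn/negP => fl.
suff : (r <= absz (l + K%:Z)%R)%N by lia.
apply: rmin; apply/existsP; exists a; apply/existsP; exists b.
by rewrite (_ : _ - _ = l) //; lia.
Qed.

(** Gaussian elimination: the pivot is moved to the upper left corner by swaps, its row and column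
    are cleared, and units are absorbed into [Q]. The remaining diagonal entry [d2] is still
    divisible by u^s, whence [s <= t]. *)
Lemma cartan_decomposition (M M' : 'M[laurent E]_2) : M *m M' = 1%:M ->
  exists P Q s t, [/\ ps_unitmx P, ps_unitmx Q, s <= t
    & M = P *m mx2 (lmono s 1) 0 0 (lmono t 1) *m Q].
Proof.
move=> MM'; have M0 : M != 0.
  apply/eqP => M0; move: MM'; rewrite M0 mul0mx => /matrixP/(_ 0 0)/eqP.
  by rewrite !mxE eq_sym oner_eq0.
have [s [i0 [j0 [Ms Ms0]]]] := min_valuation_entry M0.
pose M1 := swap i0 *m M *m swap j0.
have ME : M = swap i0 *m M1 *m swap j0.
  by rewrite /M1 !mulmxA swapK mul1mx -mulmxA swapK mulmx1.
have [M1s M1s0] : (forall i j, vge s (M1 i j)) /\ M1 0 0 s != 0.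
  have M1E : M1 = mx2 (M i0 j0) (M i0 (1 - j0)) (M (1 - i0) j0) (M (1 - i0) (1 - j0)).
    have i2 (i : 'I_2) : i = 0 \/ i = 1.
      by case: i => -[|[|//]] ?; [left|right]; apply/val_inj.
    rewrite /M1 [M]mx2_eta /swap.
    by case: (i2 i0) => ->; case: (i2 j0) => -> /=;
      rewrite ?mul1mx ?mulmx1 ?mx2M !mx2E ?subr0 ?subrr ?mx2E; congr mx2; ring.
  by rewrite M1E; split=> [i j|]; rewrite !mxE //; case: ifP; case: ifP.
clearbody M1.
have detM1 : \det M1 != 0.
  apply/eqP => d0; have := congr1 determinant MM'.
  rewrite det1 det_mulmx ME !det_mulmx d0 mulr0 !mul0r => /eqP.
  by rewrite eq_sym oner_eq0.
move: ME M1s M1s0 detM1; rewrite [M1]mx2_eta.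
move: (M1 0 0) (M1 0 1) (M1 1 0) (M1 1 1) => a b c d ME Hs.
rewrite mx2E det_mx2 => a_s detM1.
have [sa bs cs ds] : [/\ vge s a, vge s b, vge s c & vge s d].
  by have := (Hs 0 0, Hs 0 1, Hs 1 0, Hs 1 1); rewrite !mx2E => -[[[]]].
have a0 : a != 0 by apply: contra_neq a_s => ->.
have [N [w [w' [wP w'P ww' aE]]]] := laurent_unit a0.
have Ns : N = s.
  have w0 : w 0 != 0 by have [] := (power_series_unitP w).1 (conj wP (ex_intro2 _ _ w' w'P ww')).
  have [sN|Ns|//] := ltgtP N s.
    have := sa N sN; rewrite aE lcoef_monoM mul1r subrr => w00.
    by rewrite w00 eqxx in w0.
  by move: a_s; rewrite aE lcoef_monoM wP ?mulr0 ?eqxx //; lia.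
subst N.
pose b1 := lmono (- s) 1 * b * w'; pose c1 := lmono (- s) 1 * c * w'.
have uV : lmono s 1 * lmono (- s) 1 = 1 :> laurent E by rewrite lmonoM subrr mulr1.
have shiftP f : vge s f -> power_series (lmono (- s) 1 * f * w').
  by move=> fs; apply: power_seriesM => //; apply: vge_monoM; rewrite add0r opprK.
have cancel_a f : a * (lmono (- s) 1 * f * w') = f.
  rewrite aE; transitivity (lmono s 1 * lmono (- s) 1 * (w * w') * f); first by ring.
  by rewrite uV ww' !mul1r.
have ab : a * b1 = b by exact: cancel_a.
have ac : a * c1 = c by exact: cancel_a.
pose d2 := d - c1 * b.
have d2s : vge s d2.
  by apply: vgeB ds _; have := vgeM (shiftP _ cs) bs; rewrite add0r.
have d20 : d2 != 0.
  apply: contra_neq detM1 => d20; rewrite -{1}ac; transitivity (a * d2).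
    by rewrite /d2; ring.
  by rewrite d20 mulr0.
have [t [v [v' [vP v'P vv' dE]]]] := laurent_unit d20.
have st : s <= t.
  have v0 : v 0 != 0 by have [] := (power_series_unitP v).1 (conj vP (ex_intro2 _ _ v' v'P vv')).
  rewrite leNgt; apply/negP => ts; have := d2s t ts.
  by rewrite dE lcoef_monoM mul1r subrr => v00; rewrite v00 eqxx in v0.
have P1 := @power_series1 E.
have LU : ps_unitmx (mx2 1 0 c1 1).
  split; first by apply: power_series_mx2 => //; exact: shiftP.
  exists (mx2 1 0 (- c1) 1); last by rewrite mx2M -mx2_1; congr mx2; ring.
  by apply: power_series_mx2 => //; apply: vgeN; exact: shiftP.
have RU : ps_unitmx (mx2 1 b1 0 1).
  split; first by apply: power_series_mx2 => //; exact: shiftP.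
  exists (mx2 1 (- b1) 0 1); last by rewrite mx2M -mx2_1; congr mx2; ring.
  by apply: power_series_mx2 => //; apply: vgeN; exact: shiftP.
have DU : ps_unitmx (mx2 w 0 0 v).
  split; first exact: power_series_mx2.
  exists (mx2 w' 0 0 v'); first exact: power_series_mx2.
  by rewrite mx2M -mx2_1 ww' vv'; congr mx2; ring.
have core : mx2 a b c d =
    mx2 1 0 c1 1 *m mx2 (lmono s 1) 0 0 (lmono t 1) *m (mx2 w 0 0 v *m mx2 1 b1 0 1).
  move: (lmono s 1) (lmono t 1) aE dE => us ut aE dE.
  have -> : d = d2 + c1 * b by rewrite /d2 subrK.
  rewrite dE -ab -ac aE !mx2M; clear.
  by congr mx2; ring.
exists (swap i0 *m mx2 1 0 c1 1), (mx2 w 0 0 v *m mx2 1 b1 0 1 *m swap j0), s, t; split=> //.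
- exact: ps_unitmxM.
- by do 2?apply: ps_unitmxM.
by rewrite ME core !mulmxA.
Qed.

End Cartan.

(** * Linear algebra on the circle Z/n *)

Section CyclicOrder.
Context {n : nat}.

Lemma ordS_reach (i j : 'I_n) : exists r, iter r (@ordS n) i = j.
Proof.
have it r : iter r (@ordS n) i = ((i + r) %% n)%N :> nat.
  elim: r => [|r IH] /=; first by rewrite addn0 modn_small.
  by rewrite IH -addn1 modnDml -addnA addn1.
exists (n - i + j)%N; apply/val_inj; rewrite [LHS]it addnA subnKC; last exact: ltnW.
by rewrite modnDl modn_small.
Qed.

Lemma ordS_closed (S : {set 'I_n}) i :
  i \in S -> (forall j, j \in S -> ordS j \in S) -> forall j, j \in S.
Proof.
move=> iS SS j; have [r <-] := ordS_reach i j.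
by elim: r => //= r; exact: SS.
Qed.

(* In the Leibniz expansion of the cyclic bidiagonal matrix only the identity and the
   cyclic shift can contribute, and both products vanish. *)
Lemma cyclic_kernel (E : fieldType) (c d : 'I_n -> E) i0 j0 : c i0 = 0 -> d j0 = 0 ->
  exists2 la : 'I_n -> E, exists i, la i != 0 & forall i, c i * la i = d i * la (ordS i).
Proof.
move=> ci0 dj0.
pose Y : 'M[E]_n := \matrix_(j, i) (c j *+ (i == j) - d j *+ (i == ordS j)).
suff /eqP/det0P[v v0 vY] : \det Y^T = 0.
  exists (v 0) => [|j].
    apply: contrapT => v0'; case/eqP: v0; apply/rowP => i; rewrite [RHS]mxE.
    by apply/eqP; apply/negPn/negP => vi; apply: v0'; exists i.
  have /rowP/(_ j) := vY; rewrite !mxE.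
  under eq_bigr do rewrite !mxE mulrBr.
  rewrite sumrB (bigD1 j) //= big1 => [|i /negbTE ->]; last by rewrite mulr0.
  rewrite (bigD1 (ordS j)) //= big1 => [|i /negbTE ->]; last by rewrite mulr0.
  by rewrite !eqxx !addr0 mulrC [v 0 _ * _]mulrC => /eqP; rewrite subr_eq0 => /eqP.
rewrite det_tr /determinant big1 // => s _; apply/eqP; rewrite mulf_eq0; apply/orP; right.
apply/negPn/negP => /prodf_neq0 Ys.
have {}Ys j : Y j (s j) != 0 by exact: Ys.
(* Row [j] is supported on the columns [j] and [ordS j]. *)
have sE j : s j = j \/ s j = ordS j.
  have := Ys j; rewrite mxE; case: (s j =P j) => [->|_]; first by left.
  by case: (s j =P ordS j) => [->|_]; [right|rewrite subrr eqxx].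
have sj0 : s j0 = j0.
  have := Ys j0; rewrite mxE dj0 mul0rn subr0; case: (s j0 =P j0) => // _.
  by rewrite eqxx.
(* By injectivity, fixed points propagate backwards along the circle, hence from [j0] to [i0]. *)
have spred j : s (ordS j) = ordS j -> s j = j.
  by case: (sE j) => // sj sSj; rewrite -sj in sSj; have := perm_inj sSj; rewrite sj.
have si0 : s i0 = i0.
  have [r ri0] := ordS_reach i0 j0; rewrite -ri0 in sj0.
  elim: r i0 {ci0 ri0} sj0 => [//|r IH] i; rewrite iterSr => /IH; exact: spred.
have := Ys i0; rewrite si0 mxE ci0 mul0rn sub0r oppr_eq0.
(* The two terms of a diagonal entry overlap only on a circle with one element; there [i0 = j0], so
   both vanish. *)
case: (i0 =P ordS i0) => [i0S|]; last by rewrite eqxx.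
have [r ri0] := ordS_reach i0 j0.
have {}ri0 : i0 = j0 by rewrite -ri0; elim: r {ri0} => //= r <-.
by rewrite ri0 dj0 eqxx.
Qed.

(** The sum of the absolute values is invariant under the cyclic shift, yet gets multiplied by
    [p > 1]. *)
Lemma cyclic_fixpoint0 p (w : 'I_n -> int) : (1 < p)%N ->
  (forall i, w (ordS i) = p%:Z * w i) -> forall i, w i = 0.
Proof.
move=> p_gt1 wS i.
have : (\sum_j absz (w j) = p * \sum_j absz (w j))%N.
  rewrite {1}(reindex_inj (@ordS_inj n)) big_distrr /=; apply: eq_bigr => j _.
  by rewrite wS abszM.
rewrite (bigD1 i) //=; nia.
Qed.

End CyclicOrder.

(** * Diagonal translates and their weights *)

Section Shift.
Context {n : nat} (E : fieldType).
Implicit Types (a b : 'I_n -> nat) (i : 'I_n).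

Definition shift a i : 'M[laurent E]_2 :=
  mx2 (lmono (- (a i)%:Z) 1) 0 0 (lmono (a i)%:Z 1).
Definition unshift a i : 'M[laurent E]_2 :=
  mx2 (lmono (a i)%:Z 1) 0 0 (lmono (- (a i)%:Z) 1).

Lemma shiftK a i : shift a i *m unshift a i = 1%:M.
Proof.
rewrite mx2M !lmonoM -mx2_1 !mulr0 !mul0r !add0r !addr0 addrC subrr mulr1.
by congr mx2; ring.
Qed.

Lemma shiftD a b i : shift a i *m shift b i = shift (fun i => a i + b i)%N i.
Proof.
rewrite mx2M !lmonoM /shift !mulr0 !mul0r !add0r !addr0 mulr1.
by congr (mx2 (lmono _ _) _ _ (lmono _ _)); lia.
Qed.

End Shift.

Section Weights.
Context (p : nat) {n : nat}.
Implicit Types (a b : 'I_n -> nat) (i : 'I_n).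

(** Passing to the basis translated by [shift] multiplies the diagonal entries of the Frobenius
    matrix by u^-xwt and u^xwt, and the upper right and lower left ones by u^ywt and u^-ywt. *)
Definition xwt a i : int := p%:Z * (a i)%:Z - (a (ordS i))%:Z.
Definition ywt a i : int := p%:Z * (a i)%:Z + (a (ordS i))%:Z.

Lemma ywt_ge0 a i : 0 <= ywt a i.
Proof. by rewrite /ywt; lia. Qed.

End Weights.

(** * One step along a projective line *)

Section Path.
Context (p n e : nat) (p_gt1 : (1 < p)%N) (F : finFieldType) (Phi : 'I_n -> 'M[laurent F]_2).
Context (E : fieldType) (jE : {rmorphism F -> E}).

Let p_gt0 : (0 < p)%N. Proof. exact: ltnW. Qed.

Definition twist (a : 'I_n -> nat) (B : 'I_n -> 'M[laurent E]_2) i :=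
  mx2 (lmono (- xwt p a i) 1 * B i 0 0) (lmono (ywt p a i) 1 * B i 0 1)
      (lmono (- ywt p a i) 1 * B i 1 0) (lmono (xwt p a i) 1 * B i 1 1).

Lemma twistE a B i :
  unshift E a (ordS i) *m B i *m map_mx (lfrob p) (shift E a i) = twist a B i.
Proof.
rewrite [B i]mx2_eta map_mx2 !lfrob0 !(lfrob_mono p_gt0) !mx2M /twist.
rewrite !mul0r !mulr0 !addr0 !add0r.
by congr mx2; rewrite mulrAC lmonoM mulr1; congr (lmono _ _ * _); rewrite /xwt /ywt; ring.
Qed.

Lemma det_twist a B i : \det (twist a B i) = \det (B i).
Proof.
rewrite det_mx2 det_mx2E mulrACA lmonoM [X in _ - X]mulrACA lmonoM.
by rewrite addNr subrr mulr1 lmono0 !mul1r.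
Qed.

(** For integral [B] this is integrality of [twist a B]; the upper right entry is multiplied by a
    nonnegative power of u and imposes no condition. *)
Definition admissible (a : 'I_n -> nat) (B : 'I_n -> 'M[laurent E]_2) := forall i,
  [/\ vge (xwt p a i) (B i 0 0), vge (- xwt p a i) (B i 1 1) & vge (ywt p a i) (B i 1 0)].

Lemma model_data_twist a g B : model_data p e Phi jE g B -> admissible a B ->
  model_data p e Phi jE (fun i => g i *m shift E a i) (twist a B).
Proof.
move=> [gV gB BP Be] aB; split=> [i||i|i].
- have [V gVi] := gV i; exists (unshift E a i *m V).
  by rewrite mulmxA -[_ *m shift E a i *m _]mulmxA shiftK mulmx1.
- move=> i; rewrite -twistE; exact: (frob_matrix_mulr p_gt0 gB (shiftK E a) i).
- have [al de ga] := aB i.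
  apply: power_series_mx2; apply: vge_monoM; rewrite add0r ?opprK //.
  by apply: vge_le (BP i 0 1); have := ywt_ge0 p a i; lia.
- by rewrite det_twist.
Qed.

Lemma model_data_swap g B : model_data p e Phi jE g B ->
  model_data p e Phi jE (fun i => g i *m mx2 0 1 1 0)
    (fun i => mx2 (B i 1 1) (B i 1 0) (B i 0 1) (B i 0 0)).
Proof.
move=> gB; have [sP _] := @ps_unitmx_swap E.
have ss : mx2 0 1 1 0 *m mx2 0 1 1 0 = 1%:M :> 'M[laurent E]_2.
  by rewrite mx2M -mx2_1; congr mx2; ring.
have := model_data_mulr p_gt0 gB (fun=> sP) (fun=> sP) (fun=> ss).
congr model_data; apply/funext => i.
rewrite {1}[B i]mx2_eta map_mx2 lfrob0 lfrob1 // !mx2M.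
by congr mx2; ring.
Qed.

Section Step.
Context (Om : closedFieldType) (jOm : {rmorphism F -> Om}).
Context (h : {rmorphism E -> Om}) (hj : forall c, h (jE c) = jOm c).

(** Inside the support of [la] the weight is [p - 1], as assumed on alpha. On leaving the support it
    is [p], and the cyclic relation kills the coefficient of u^(p-1) in alpha; on entering it is -1,
    and the relation kills the constant term of delta. *)
Lemma step_admissible B (la : 'I_n -> E) (b := fun i => nat_of_bool (la i != 0)) :
  (forall i, power_series_mx (B i)) ->
  (forall i, la i != 0 -> vge (p%:Z - 1) (B i 0 0)) ->
  (forall i, B i 0 0 (p%:Z - 1) * la i = B i 1 1 0 * la (ordS i)) ->
  (forall i, vge (ywt p b i) (B i 1 0)) -> admissible b B.
Proof.
move=> BP alP alE gaP i; split=> //; rewrite /xwt /b.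
- have [la0|la0] := eqVneq (la i) 0; first by apply: vge_le (BP i 0 0); lia.
  have [la1|la1] /= := eqVneq (la (ordS i)) 0; last first.
    by apply: vge_le (alP i la0); lia.
  have := alE i; rewrite la1 mulr0 => /eqP; rewrite mulf_eq0 (negbTE la0) orbF => /eqP.
  by move=> /(vge_succ (alP i la0)); apply: vge_le; lia.
- have [la1|la1] := eqVneq (la (ordS i)) 0; first by apply: vge_le (BP i 1 1); lia.
  have [la0|la0] /= := eqVneq (la i) 0; last by apply: vge_le (BP i 1 1); lia.
  have := alE i; rewrite la0 mulr0 => /esym/eqP; rewrite mulf_eq0 (negbTE la1) orbF => /eqP.
  by move=> /(vge_succ (BP i 1 1 : vge 0 _)); apply: vge_le; lia.
Qed.

(* Moving the line in (u^-1 L) / L from 0 to infinity: g and its shift are both joined to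
   the lattices with bases g_i (1 + la_i u^-1 E_12). *)
Lemma step_same_component g B (la : 'I_n -> E) (b := fun i => nat_of_bool (la i != 0))
    (x y : GR_points p e Phi jE) :
  model_data p e Phi jE g B ->
  (forall i, la i != 0 -> vge (p%:Z - 1) (B i 0 0)) ->
  (forall i, B i 0 0 (p%:Z - 1) * la i = B i 1 1 0 * la (ordS i)) ->
  (forall i, vge (ywt p b i) (B i 1 0)) ->
  lattice x = lattice_of g -> lattice y = lattice_of (fun i => g i *m shift E b i) ->
  same_component hj x y.
Proof.
move=> gB alP alE gaP xE yE; have [_ _ BP _] := gB.
have bB : admissible b B by exact: step_admissible.
have p1 := p_gt1.
have lafrob (c : E) : lfrob p (lmono (-1) c) = lmono (- p%:Z) c.
  by rewrite lfrob_mono // mulrN1.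
have monoP (c : E) j f : (c != 0 -> vge (- j) f) -> power_series (lmono j c * f).
  move=> cf; have [->|c0] := eqVneq c 0; first by rewrite lmono_eq0 mul0r.
  by apply: vge_monoM; rewrite add0r; exact: cf.
pose nu i : laurent E := lmono (-1) (la i).
have [||||x1 x1E xx1] := unipotent_same_component p_gt0 hj (nu := nu) gB _ _ _ _ xE.
- move=> i; apply: monoP => l1; apply: vge_le (gaP i); rewrite /ywt /b l1; lia.
- move=> i; rewrite lafrob mulrC; apply: monoP => l0; apply: vge_le (gaP i).
  rewrite /ywt /b l0; lia.
(* The only possible polar term is in u^-1, and its coefficient vanishes by the cyclic relation. *)
- move=> i; rewrite lafrob mulrC => m m0.
  rewrite lcoefB !lcoef_monoM !opprK.
  have [->|m1] := eqVneq m (-1).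
    by rewrite addNr mulrC [-1 + _]addrC alE mulrC subrr.
  rewrite (BP i 1 1); last lia.
  have [->|l0] := eqVneq (la i) 0; first by rewrite mul0r mulr0 subrr.
  by rewrite (alP i l0) ?mulr0 ?subrr //; lia.
- move=> i; rewrite lafrob mulrC mulrA lmonoM; apply: monoP.
  rewrite mulf_eq0 => /norP[l0 l1]; apply: vge_le (gaP i); rewrite /ywt /b l0 l1; lia.
pose W : 'M[laurent E]_2 := mx2 0 1 1 0.
have yE' : lattice y = lattice_of (fun i => g i *m shift E b i *m W).
  rewrite yE; apply/esym/(@lattice_of_mulr _ _ (fun i => g i *m shift E b i) (fun=> W)) => i.
  exact: ps_unitmx_swap.
(* The chart at infinity of the same projective line, hence the inverse parameter; as 0^-1 = 0, it
   is supported where [la] is. *)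
pose mu i : laurent E := lmono (-1) (la i)^-1.
have [||||y1 y1E yy1] := unipotent_same_component p_gt0 hj (nu := mu)
    (model_data_swap (model_data_twist gB bB)) _ _ _ _ yE'.
- move=> i; rewrite !mx2E; apply: monoP; rewrite invr_eq0 => l1.
  apply: vge_monoM; apply: vge_le (BP i 0 1); rewrite /ywt /b l1; lia.
- move=> i; rewrite !mx2E lafrob mulrC; apply: monoP; rewrite invr_eq0 => l0.
  apply: vge_monoM; apply: vge_le (BP i 0 1); rewrite /ywt /b l0; lia.
(* At the ends of the support the surviving term is integral by its weight. Inside, the coefficient
   of u^-1 is the cyclic relation divided by [la i * la (ordS i)]. *)
- move=> i; rewrite !mx2E lafrob mulrC => m m0.
  rewrite !mulrA !lmonoM !mulr1.
  rewrite lcoefB !lcoef_monoM.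
  have [l0|l0] := eqVneq (la i) 0; have [l1|l1] := eqVneq (la (ordS i)) 0.
  + by rewrite l0 l1 invr0 !mul0r subrr.
  + rewrite l0 invr0 mul0r sub0r (BP i 0 0) ?mulr0 ?oppr0 // /xwt /b l0 l1 eqxx; lia.
  + rewrite l1 invr0 mul0r subr0 (BP i 1 1) ?mulr0 // /xwt /b l0 l1 eqxx; lia.
  have -> : m - (- p%:Z + xwt p b i) = m + 1 by rewrite /xwt /b l0 l1; lia.
  have -> : m - (-1 - xwt p b i) = m + p%:Z by rewrite /xwt /b l0 l1; lia.
  have [->|m1] := eqVneq m (-1); last first.
    by rewrite (BP i 1 1) ?(alP i l0) ?mulr0 ?subrr //; lia.
  rewrite addNr [-1 + _]addrC; apply/eqP; rewrite subr_eq0; apply/eqP.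
  apply: (mulfI l0); rewrite mulVKf //; apply: (mulfI l1).
  by rewrite mulrCA mulVKf // mulrC -alE mulrC.
- move=> i; rewrite !mx2E lafrob mulrC (mulrA (lmono (- p%:Z) _)) lmonoM; apply: monoP.
  rewrite mulf_eq0 !invr_eq0 => /norP[l0 l1].
  apply: vge_monoM; apply: vge_le (BP i 0 1); rewrite /ywt /b l0 l1; lia.
suff x1y1 : x1 = y1.
  apply: connected_component_trans xx1 _; rewrite x1y1.
  exact: connected_component_sym yy1.
apply: GR_points_eq; rewrite x1E y1E.
(* The integral change of basis identifying the two charts; off the support both parameters vanish
   and only the swap remains. *)
pose K i : 'M[laurent E]_2 := if la i == 0 then W else
  mx2 (lmono 0 (- la i)) 0 (lmono 1 1) (lmono 0 (la i)^-1).
rewrite -(@lattice_of_mulr _ _ (fun i => g i *m mx2 1 (nu i) 0 1) K) => [|i].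
  congr lattice_of; apply/funext => i; rewrite -!mulmxA; congr (_ *m _).
  rewrite /K /shift /mu /nu /b; case: eqP => [->|/eqP l0] /=.
    by rewrite invr0 !lmono_eq0 oppr0 !lmono0 mx2_1 !mul1mx mulmx1.
  have uv : lmono 1 1 * lmono (-1) 1 = 1 :> laurent E by rewrite lmonoM mulr1.
  have lm : lmono 0 (la i) * lmono 0 (la i)^-1 = 1 :> laurent E by rewrite lmonoM mulfV.
  have -> : lmono 0 (- la i) = - lmono 0 (la i).
    by apply: laurentP => m /=; case: eqP; rewrite ?oppr0.
  have vc c : lmono (-1) c = lmono (-1) 1 * lmono 0 c :> laurent E.
    by rewrite lmonoM addr0 mul1r.
  rewrite (vc (la i)) (vc (la i)^-1) /W.
  move: (lmono 1 1) (lmono (-1) 1) (lmono 0 (la i)) (lmono 0 (la i)^-1) uv lm.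
  move=> u v l m uv lm; rewrite !mx2M; congr mx2.
  - by transitivity (l * (u * v) - l); [ring|rewrite uv; ring].
  - by transitivity (v * (l * m)); [ring|rewrite lm; ring].
  - by ring.
  - by transitivity (u * v * m); [rewrite uv; ring|ring].
rewrite /K; case: eqP => [_|/eqP l0]; first exact: ps_unitmx_swap.
have c0 (c : E) : power_series (lmono 0 c) by exact: (power_series_mono 0).
have u1 : power_series (lmono 1 1 : laurent E) by exact: (power_series_mono 1).
split; first exact: power_series_mx2.
exists (mx2 (lmono 0 (- (la i)^-1)) 0 (lmono 1 1) (lmono 0 (la i))).
  exact: power_series_mx2.
rewrite mx2M !lmonoM !mulr0 !mul0r !addr0 !add0r mulrNN mulfV // mulVf // -mx2_1.
congr mx2; rewrite mul1r mulr1.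
by apply: laurentP => m /=; case: eqP; rewrite ?addNr ?addr0.
Qed.

End Step.
End Path.

(** * Connecting two non-ordinary models *)

Section Connect.
Context (p n e : nat) (p_gt1 : (1 < p)%N) (F : finFieldType) (Phi : 'I_n -> 'M[laurent F]_2).
Context (E : fieldType) (jE : {rmorphism F -> E}).
Implicit Types (g B : 'I_n -> 'M[laurent E]_2) (a : 'I_n -> nat).

Let p_gt0 : (0 < p)%N. Proof. exact: ltnW. Qed.

Lemma ue_unit_vge (f : laurent E) (N : int) : ue_unit e f -> vge N f -> N <= e%:Z.
Proof.
move=> [al /power_series_unitP[alP al0] ->] fN; rewrite leNgt; apply/negP => eN.
by have := fN _ eN; rewrite lcoef_monoM mul1r subrr => al00; rewrite al00 eqxx in al0.
Qed.

Lemma vge_ue_unit (f : laurent E) : ue_unit e f -> vge e%:Z f.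
Proof. by move=> [al [alP _] ->]; apply: vge_monoM; rewrite subrr. Qed.

Lemma vge_divr_unit (f d : laurent E) (N : int) :
  power_series d -> d 0 != 0 -> vge N (f * d) -> vge N f.
Proof.
move=> dP d0 fd; have [_ [d' d'P dd']] := (power_series_unitP d).2 (conj dP d0).
have := vgeM fd (d'P : vge 0 _); rewrite -mulrA dd' mulr1; apply: vge_le; lia.
Qed.

(* S is a maximal set on which alpha is divisible enough. Unless S is the full circle, the
   equation at its boundary is void, so that the system has a nonzero solution. *)
Lemma exists_step B a :
  (forall i, power_series_mx (B i)) -> (forall i, ue_unit e (\det (B i))) ->
  admissible p a B -> (exists i, (0 < a i)%N) ->
  ((forall i, (0 < a i)%N) -> exists i, B i 1 1 0 = 0) ->
  ((forall i, (0 < a i)%N) -> exists i, B i 0 0 (xwt p a i) = 0) ->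
  exists la : 'I_n -> E, [/\ exists i, la i != 0,
    forall i, la i != 0 -> (0 < a i)%N /\ vge (p%:Z - 1) (B i 0 0)
    & forall i, B i 0 0 (p%:Z - 1) * la i = B i 1 1 0 * la (ordS i)].
Proof.
move=> BP Be aB [i2 ai2] H1 H2; have p1 := p_gt1.
have [i1 amax] : exists i1, forall i, (a i <= a i1)%N.
  by case: (@arg_maxnP _ i2 xpredT a) => // i1 _ i1P; exists i1 => i; exact: i1P.
set M := a i1 in amax.
have M_gt0 : (0 < M)%N by exact: leq_trans (amax i2).
have xM i : a i = M -> ((p%:Z - 1) * M%:Z <= xwt p a i).
  by move=> aiM; rewrite /xwt aiM; have := amax (ordS i); nia.
(* At the maximum of [a] both products in the determinant are divisible by u^xwt, while the
   determinant has valuation exactly [e]. *)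
have eM : (p%:Z - 1) * M%:Z <= e%:Z.
  apply: le_trans (xM i1 erefl) _; apply: ue_unit_vge (Be i1) _.
  have [al _ ga] := aB i1; rewrite det_mx2E; apply: vgeB.
    by have := vgeM al (BP i1 1 1 : vge 0 _); apply: vge_le; lia.
  by have := vgeM (BP i1 0 1 : vge 0 _) ga; apply: vge_le; rewrite /xwt /ywt; lia.
pose Q (T : {set 'I_n}) := [forall i in T, [&& (0 < a i)%N, `[< vge (p%:Z - 1) (B i 0 0) >]
  & (ordS i \in T) || `[< vge p%:Z (B i 0 0) >]]].
(* The set where [a] is maximal has property [Q]: where it ends, [a] drops by at least one, so the
   weight is at least (p - 1) M + 1 >= p. *)
pose T0 : {set 'I_n} := [set i | a i == M]%SET.
have QT0 : Q T0.
  apply/forall_inP => i; rewrite inE => /eqP aiM; have [al _ _] := aB i.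
  rewrite aiM M_gt0 /=; apply/andP; split.
    by apply/asboolP; apply: vge_le al; have := xM i aiM; nia.
  rewrite inE; have [//|aSM] := eqVneq (a (ordS i)) M; apply/asboolP; apply: vge_le al.
  by rewrite /xwt aiM; have := amax (ordS i); nia.
have [S /maxsetP[/forall_inP QS Smax] T0S] := maxset_exists QT0.
have iS : i1 \in S by apply: (fintype.subsetP T0S); rewrite inE.
(* Otherwise delta is a unit at [i], which forces 0 < a_i < M and so M >= 2. Then alpha = (det +
   beta gamma) / delta is divisible by u^p, since e >= (p - 1) M >= p and the weight of gamma is at
   least p, and [i] could be added to [S]. *)
have back i : i \notin S -> ordS i \in S -> B i 1 1 0 = 0.
  move=> iNS SiS; apply/eqP; apply/negPn/negP => de0; case/negP: (iNS).
  have [al de ga] := aB i; have /and3P[aSi _ _] := QS _ SiS.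
  have x0 : 0 <= xwt p a i.
    rewrite leNgt; apply/negP => x0; move/eqP: de0; apply; apply: de; lia.
  have ai : (0 < a i)%N by move: x0; rewrite /xwt; nia.
  have aiM : (a i < M)%N.
    rewrite ltn_neqAle amax andbT; apply/negP => aiM.
    have iT0 : i \in T0 by rewrite inE.
    by move: iNS; rewrite (fintype.subsetP T0S _ iT0).
  have alp : vge p%:Z (B i 0 0).
    apply: (vge_divr_unit (BP i 1 1) de0).
    have -> : B i 0 0 * B i 1 1 = \det (B i) + B i 0 1 * B i 1 0.
      by rewrite det_mx2E subrK.
    apply: vgeD; first by apply: vge_le (vge_ue_unit (Be i)); nia.
    have := vgeM (BP i 0 1 : vge 0 _) ga; apply: vge_le; rewrite /ywt; nia.
  have <- : (i |: S)%SET = S; last by rewrite !inE eqxx.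
  apply: Smax; last by apply/fintype.subsetP => j jS; rewrite !inE jS orbT.
  apply/forall_inP => j; rewrite !inE => /orP[/eqP ->|/QS /and3P[aj alj]].
    rewrite ai SiS orbT /= andbT; apply/asboolP; apply: vge_le alp; lia.
  by move=> /orP[Sj|alpj]; rewrite aj alj /= ?Sj ?alpj ?orbT.
have frontier i : i \in S -> ordS i \notin S -> B i 0 0 (p%:Z - 1) = 0.
  move=> /QS/and3P[_ _ /orP[->//|/asboolP alp]] _; apply: alp; lia.
(* The system is altered outside [S] to force [la] to vanish there, and on leaving [S] the equation
   becomes 0 = 0. *)
pose c i := if i \in S then (if ordS i \in S then B i 0 0 (p%:Z - 1) else 0) else 1.
pose d i := if (i \in S) && (ordS i \in S) then B i 1 1 0 else 0.
have [[i0 ci0] [j0 dj0]] : (exists i, c i = 0) /\ (exists j, d j = 0).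
  have [Sall|] := pselect (forall i, i \in S); last first.
    move=> Sall; have [i [iS' SiS]] : exists i, i \in S /\ ordS i \notin S.
      apply: contrapT => NS; apply: Sall; apply: (ordS_closed iS) => j jS.
      by apply/negPn/negP => SjS; apply: NS; exists j.
    by split; exists i; rewrite /c /d iS' (negbTE SiS).
  have a_gt0 i : (0 < a i)%N by have /and3P[] := QS i (Sall i).
  split; last by have [i di] := H1 a_gt0; exists i; rewrite /d !Sall.
  (* If no coefficient of u^(p-1) vanishes, all weights are at most [p - 1], hence [M = 1] and [a]
     is constant equal to 1, against [H2]. *)
  apply: contrapT => Nc.
  have al0 i : B i 0 0 (p%:Z - 1) != 0.
    by apply/eqP => ci; apply: Nc; exists i; rewrite /c !Sall.
  have xle i : xwt p a i <= p%:Z - 1.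
    rewrite leNgt; apply/negP => xp; have [al _ _] := aB i.
    by move/eqP: (al0 i); apply; exact: al.
  have M1 : M = 1%N by have := xM i1 erefl; have := xle i1; nia.
  have a1 i : a i = 1%N by have := amax i; have := a_gt0 i; lia.
  have [i] := H2 a_gt0; rewrite /xwt !a1 mulr1 => /eqP.
  by rewrite (negbTE (al0 i)).
have [la laN0 laE] := cyclic_kernel ci0 dj0.
have la_out i : i \notin S -> la i = 0.
  by move=> iNS; have := laE i; rewrite /c /d (negbTE iNS) /= mul1r mul0r.
exists la; split=> // i.
  move=> lai; have iS' : i \in S by apply/negPn/negP => /la_out li; rewrite li eqxx in lai.
  by have /and3P[-> /asboolP] := QS i iS'.
have := laE i; rewrite /c /d.
have [iS'|iNS] := boolP (i \in S); have [SiS|SiNS] := boolP (ordS i \in S) => //= _.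
- by rewrite (frontier i) // (la_out (ordS i)) // mul0r mulr0.
- by rewrite (back i) // (la_out i) // mul0r mulr0.
- by rewrite (la_out i) // (la_out (ordS i)) // !mulr0.
Qed.

Context (Om : closedFieldType) (jOm : {rmorphism F -> Om}).
Context (h : {rmorphism E -> Om}) (hj : forall c, h (jE c) = jOm c).

Lemma xwtB a b i : (forall i, (b i <= a i)%N) ->
  xwt p (fun i => a i - b i)%N i = xwt p a i - xwt p b i.
Proof. by move=> ba; rewrite /xwt; have := ba i; have := ba (ordS i); nia. Qed.

Lemma ywtB a b i : (forall i, (b i <= a i)%N) ->
  ywt p (fun i => a i - b i)%N i = ywt p a i - ywt p b i.
Proof. by move=> ba; rewrite /ywt; have := ba i; have := ba (ordS i); nia. Qed.

(** Induction on the sum of [a]: a step along the support of [la] lowers it. When [a] is everywhere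
    positive, the two vanishing hypotheses are what excludes an etale line in the source and in the
    target respectively. *)
Lemma shift_same_component g B a (x y : GR_points p e Phi jE) :
  model_data p e Phi jE g B -> admissible p a B ->
  ((forall i, (0 < a i)%N) -> exists i, B i 1 1 0 = 0) ->
  ((forall i, (0 < a i)%N) -> exists i, B i 0 0 (xwt p a i) = 0) ->
  lattice x = lattice_of g -> lattice y = lattice_of (fun i => g i *m shift E a i) ->
  same_component hj x y.
Proof.
have p1 := p_gt1.
have [N] := ubnP (\sum_i a i); elim: N => // N IH in g B a x y *.
move=> aN gB aB H1 H2 xE yE; have [_ _ BP Be] := gB.
have [a_gt0|a0] := pselect (exists i, (0 < a i)%N); last first.
  have -> : x = y; last exact: connected_component_refl.
  apply: GR_points_eq; rewrite xE yE; congr lattice_of; apply/funext => i.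
  have -> : shift E a i = 1%:M; last by rewrite mulmx1.
  have -> : a = fun=> 0%N.
    apply/funext => j; apply/eqP; rewrite -leqn0 leqNgt; apply/negP => aj.
    by apply: a0; exists j.
  by rewrite /shift oppr0 mx2_1.
have [la [[i0 lai0] laP laE]] := exists_step BP Be aB a_gt0 H1 H2.
pose b i := nat_of_bool (la i != 0).
have ba i : (b i <= a i)%N.
  by rewrite /b; case: eqP => //= /eqP lai; case: (laP i lai).
have yba i : ywt p b i <= ywt p a i.
  by rewrite /ywt; have := ba i; have := ba (ordS i); nia.
have gaP i : vge (ywt p b i) (B i 1 0) by case: (aB i) => _ _; exact: vge_le.
have alP i : la i != 0 -> vge (p%:Z - 1) (B i 0 0) by case/laP.
have bB : admissible p b B by exact: step_admissible.
have gB' := model_data_twist p_gt1 gB bB.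
have [z zE] := exists_point gB'.
have xz : same_component hj x z by exact: (step_same_component p_gt1 hj gB alP laE gaP xE zE).
apply: connected_component_trans xz _.
pose a' i := (a i - b i)%N.
apply: (IH _ _ a' z y _ gB') => //.
- have : (\sum_i a' i < \sum_i a i)%N; last by lia.
  rewrite (bigD1 i0) //= [X in (_ < X)%N](bigD1 i0) //= -addSn leq_add //.
    by have := ba i0; rewrite /a' /b lai0 /=; lia.
  by apply: leq_sum => i _; exact: leq_subr.
- move=> i; have [al de ga] := aB i; rewrite !mx2E (xwtB _ ba) (ywtB _ ba).
  split; apply: vge_monoM; [apply: vge_le al|apply: vge_le de|apply: vge_le ga]; lia.
(* At a point of the support the weight of [b] is at least [p - 1 > 0], so the new delta has no
   constant term. *)
- move=> _; exists i0; rewrite mx2E lcoef_monoM mul1r sub0r BP //.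
  by rewrite /xwt /b lai0; case: (la (ordS i0) != 0); lia.
(* Twisting by [b] lowers both the weight and the exponents of alpha by [xwt p b i]: the coefficient
   in question is unchanged. *)
- move=> a'_gt0; have [|i Bi] := H2.
    by move=> i; apply: leq_trans (a'_gt0 i) (leq_subr _ _).
  by exists i; rewrite mx2E lcoef_monoM mul1r (xwtB _ ba) opprK subrK.
- rewrite yE; congr lattice_of; apply/funext => i; rewrite -mulmxA shiftD.
  by congr (_ *m _); rewrite /shift /a' subnKC.
Qed.

Lemma lmono_unit_inj (m m' : int) (w w' : laurent E) :
  power_series_unit w -> power_series_unit w' -> lmono m 1 * w = lmono m' 1 * w' -> m = m'.
Proof.
move=> /power_series_unitP[wP w0] /power_series_unitP[w'P w'0] eq.
have [mm'|mm'|//] := ltgtP m m'.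
  have := congr1 (@lcoef E ^~ m) eq; rewrite !lcoef_monoM !mul1r subrr (w'P (m - m')); last lia.
  by move=> w00; rewrite w00 eqxx in w0.
have := congr1 (@lcoef E ^~ m') eq; rewrite !lcoef_monoM !mul1r subrr (wP (m' - m)); last lia.
by move=> /esym w00; rewrite w00 eqxx in w'0.
Qed.

(** The Cartan decomposition of each transition matrix gives diagonal exponents s_i <= t_i. The
    determinant condition on both lattices forces s_i + t_i = 0, and admissibility is the
    integrality of Frobenius on the second lattice. *)
Lemma adapted_bases (x y : GR_points p e Phi jE) : exists g B a,
  [/\ model_data p e Phi jE g B, admissible p a B, lattice x = lattice_of g
    & lattice y = lattice_of (fun i => g i *m shift E a i)].
Proof.
have [g1 /model_dataP[B1 g1B1] xE] := latticeP x.
have [g2 /model_dataP[B2 g2B2] yE] := latticeP y.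
have [g1V _ _ _] := g1B1; have [g2V _ _ _] := g2B2.
have /choice[V1 g1V1] := g1V; have /choice[V2 g2V2] := g2V.
have /choice[D DP] : forall i, exists D : 'M[laurent E]_2 * 'M[laurent E]_2 * int * int,
    [/\ ps_unitmx D.1.1.1, ps_unitmx D.1.1.2, D.1.2 <= D.2 &
     V1 i *m g2 i = D.1.1.1 *m mx2 (lmono D.1.2 1) 0 0 (lmono D.2 1) *m D.1.1.2].
  move=> i; have VV : (V1 i *m g2 i) *m (V2 i *m g1 i) = 1%:M.
    by rewrite mulmxA -[V1 i *m g2 i *m V2 i]mulmxA g2V2 mulmx1; exact: mulmx1C.
  have [P [Q [s [t [PU QU st VE]]]]] := cartan_decomposition VV.
  by exists (P, Q, s, t).
pose P i := (D i).1.1.1; pose Q i := (D i).1.1.2; pose s i := (D i).1.2; pose t i := (D i).2.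
have PU i : ps_unitmx (P i) by case: (DP i).
have QU i : ps_unitmx (Q i) by case: (DP i).
have st i : s i <= t i by case: (DP i).
have /choice[P' P'P] : forall i, exists P', power_series_mx P' /\ P i *m P' = 1%:M.
  by move=> i; have [_ [P' ? ?]] := PU i; exists P'.
have /choice[Q' Q'P] : forall i, exists Q', power_series_mx Q' /\ Q i *m Q' = 1%:M.
  by move=> i; have [_ [Q' ? ?]] := QU i; exists Q'.
pose g i := g1 i *m P i; pose B i := P' (ordS i) *m B1 i *m map_mx (lfrob p) (P i).
have gB : model_data p e Phi jE g B.
  by apply: model_data_mulr => // i; [case: (PU i)|case: (P'P i)|case: (P'P i)].
pose g' i := g2 i *m Q' i; pose B' i := Q (ordS i) *m B2 i *m map_mx (lfrob p) (Q' i).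
have g'B' : model_data p e Phi jE g' B'.
  apply: model_data_mulr => // i; [by case: (Q'P i)|by case: (QU i)|].
  by apply: mulmx1C; case: (Q'P i).
clearbody B B'.
pose De i : 'M[laurent E]_2 := mx2 (lmono (s i) 1) 0 0 (lmono (t i) 1).
pose De' i : 'M[laurent E]_2 := mx2 (lmono (- s i) 1) 0 0 (lmono (- t i) 1).
have DeK i : De i *m De' i = 1%:M.
  rewrite mx2M !lmonoM !subrr !mulr1 !mul0r !mulr0 !addr0 !add0r; exact: mx2_1.
have g'E i : g' i = g i *m De i.
  have [_ _ _ VE] := DP i; rewrite /g' /g.
  have -> : g2 i = g1 i *m (V1 i *m g2 i) by rewrite mulmxA g1V1 mul1mx.
  rewrite VE -!mulmxA; congr (_ *m (_ *m _)); rewrite -[RHS]mulmx1; congr (_ *m _).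
  by case: (Q'P i).
have B'E i : B' i = De' (ordS i) *m B i *m map_mx (lfrob p) (De i).
  have [g'V g'B'f _ _] := g'B'; have [_ gBf _ _] := gB.
  apply: (frob_matrix_inj g'V g'B'f (B' := fun i => _)).
  have -> : g' = fun i => g i *m De i by apply/funext.
  exact: frob_matrix_mulr.
(* Both Frobenius determinants have valuation [e], so the sums w_i = s_i + t_i satisfy w_(i+1) = p
   w_i around the circle. *)
have w0 i : s i + t i = 0.
  move: i; apply: (cyclic_fixpoint0 p_gt1) => i.
  have [_ _ _ Be] := gB; have [_ _ _ Be'] := g'B'.
  have [al alU alE] := Be i; have [al' al'U al'E] := Be' i.
  move: al'E; rewrite B'E !det_mulmx alE det_map_frob // !det_mx2 !mul0r !subr0 !lmonoM !mulr1.
  rewrite lfrob_mono //.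
  have -> : forall f1 f2 f3 f4 : laurent E, f1 * (f2 * f3) * f4 = f2 * (f1 * f4 * f3).
    by move=> *; ring.
  rewrite lmonoM mulr1 mulrA lmonoM mulr1 => /(lmono_unit_inj alU al'U); lia.
pose a i := absz (t i).
have DeE i : De i = shift E a i.
  rewrite /De /shift /a; congr (mx2 (lmono _ _) _ _ (lmono _ _));
    by have := w0 i; have := st i; lia.
have De'E i : De' i = unshift E a i.
  rewrite /De' /unshift /a; congr (mx2 (lmono _ _) _ _ (lmono _ _));
    by have := w0 i; have := st i; lia.
exists g, B, a; split=> //.
- move=> i; have [_ _ BP' _] := g'B'; have := BP' i.
  rewrite B'E De'E DeE twistE // => /power_series_mx2_inv[al _ ga de].
  have := (monoM_vge (al : vge 0 _), monoM_vge (ga : vge 0 _), monoM_vge (de : vge 0 _)).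
  by rewrite !sub0r !opprK => -[[? ?] ?].
- by rewrite xE /g lattice_of_mulr.
- have -> : (fun i => g i *m shift E a i) = g' by apply/funext => i; rewrite g'E DeE.
  rewrite yE /g' lattice_of_mulr // => i; split; first by case: (Q'P i).
  exists (Q i); first by case: (QU i).
  by apply: mulmx1C; case: (Q'P i).
Qed.

Lemma nonordinary_same_component (x y : GR_points p e Phi jE) : (0 < e)%N ->
  ~ ordinary x -> ~ ordinary y -> same_component hj x y.
Proof.
move=> e_gt0 xN yN; have [g [B [a [gB aB xE yE]]]] := adapted_bases x y.
apply: (shift_same_component gB aB _ _ xE yE) => a_gt0; apply: contrapT => NB.
  apply: xN; apply: (etale_ordinary p_gt0 e_gt0 gB xE) => i.
    by case: (aB i) => _ _; apply: vge_le; rewrite /ywt; have := a_gt0 i; nia.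
  by apply/eqP => Bi; apply: NB; exists i.
(* The swap puts the twisted alpha in the place of delta; its constant term is the coefficient of
   alpha at [xwt p a i], so the criterion for an etale line applies to [y]. *)
apply: yN; have yE' : lattice y =
    lattice_of (fun i => g i *m shift E a i *m mx2 0 1 1 0).
  rewrite yE; apply/esym/(@lattice_of_mulr _ _ (fun i => g i *m shift E a i) (fun=> _)) => i.
  exact: ps_unitmx_swap.
apply: (etale_ordinary p_gt0 e_gt0 (model_data_swap p_gt1 (model_data_twist p_gt1 gB aB)) yE').
  move=> i; have [_ _ BP _] := gB; rewrite !mx2E; apply: vge_monoM; apply: vge_le (BP i 0 1).
  by rewrite /ywt; have := a_gt0 i; nia.
move=> i; rewrite !mx2E lcoef_monoM mul1r sub0r opprK.
by apply/eqP => Bi; apply: NB; exists i.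
Qed.

End Connect.

Theorem theorem2p4
  (p n e : nat) (p_prime : prime p) (p_gt2 : (2 < p)%N)
  (k : finFieldType) (card_k : #|k| = (p ^ n)%N)
  (K0 : fieldType) (v0 : K0 -> int) (red : K0 -> k)
  (K0_witt : witt_fraction_field p v0 red)
  (K : fieldExtType K0) (v : K -> int) (pi : K)
  (K_ram : totally_ramified v0 v e pi)
  (Kbar : closedFieldType) (jK : {rmorphism K -> Kbar})
  (Kbar_alg : algebraic_closure jK)
  (pi_ : nat -> Kbar) (pi_roots : uniformizer_roots p pi jK pi_)
  (F : finFieldType) (iota : {rmorphism k -> F})
  (rho : {rmorphism Kbar -> Kbar} -> 'M[F]_2)
  (rho_rep : galois_rep jK rho) (rho_flat : finite_flat v jK rho)
  (Phi : 'I_n -> 'M[laurent F]_2)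
  (Phi_rho : etale_phi_module_of p e v0 red v jK iota pi_ rho Phi)
  (F' : finFieldType) (jF' : {rmorphism F -> F'})
  (x1 x2 : GR_points p e Phi jF')
  (x1_nonord : ~ ordinary x1) (x2_nonord : ~ ordinary x2)
  (Om : closedFieldType) (jOm : {rmorphism F -> Om})
  (h : {rmorphism F' -> Om}) (hj : forall c, h (jF' c) = jOm c) :
  connected_component [set: GR_space p e Phi jOm] (GR_map hj x1) (GR_map hj x2).
Proof.
have [dimK _ _ _ _] := K_ram.
have e_gt0 : (0 < e)%N by rewrite -dimK; exact: (adim_gt0 {:K}%AS).
exact: (nonordinary_same_component (ltnW p_gt2) hj e_gt0 x1_nonord x2_nonord).
Qed.
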